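(* Let $\theta=2$, $\Sigma=\{0\}\times\mathbb{R}\subset\mathbb{R}^2$, $q=\frac12\chi_{(-1,1)}$, and let $\eta,\tau\in\mathbb{R}$ be constants such that $d:=\eta^2-\tau^2>\frac{\pi^2}{4}$ and $d\ne(2k+1)^2\pi^2$ for all $k\in\mathbb{N}_0$. Let $V=\eta I_2+\tau\sigma_3$ with associated operators $H_{V_\varepsilon}$, $\varepsilon>0$, and set $\widetilde V=\widetilde\eta I_2+\widetilde\tau\sigma_3$ with $(\widetilde\eta,\widetilde\tau)=\mathrm{tanc}\bigl(\tfrac{\sqrt d}{2}\bigr)(\eta,\tau)$. Moreover, assume that $\widetilde d:=\widetilde\eta^{\,2}-\widetilde\tau^{\,2}\ne4$. Then $H_{V_\varepsilon}$ does not converge in the norm resolvent sense to $H_{\widetilde V\delta_\Sigma}$ as $\varepsilon\to0$.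
   Context: $m\in\mathbb{R}$ is fixed and $\sigma_1=\begin{pmatrix}0&1\\1&0\end{pmatrix}$, $\sigma_2=\begin{pmatrix}0&-i\\i&0\end{pmatrix}$, $\sigma_3=\begin{pmatrix}1&0\\0&-1\end{pmatrix}$; for $\theta=2$ the Dirac matrices are $\alpha_1=\sigma_1$, $\alpha_2=\sigma_2$, $\beta=\sigma_3$. For $\varepsilon>0$ the localized potential is $V_\varepsilon=\frac1{2\varepsilon}V\chi_{(-\varepsilon,\varepsilon)\times\mathbb{R}}$, and $H_{V_\varepsilon}$ is the self-adjoint operator in $L^2(\mathbb{R}^2;\mathbb{C}^2)$ given by $H_{V_\varepsilon}u=-i\sigma_1\partial_1u-i\sigma_2\partial_2u+m\sigma_3u+V_\varepsilon u$, $\mathrm{dom}\,H_{V_\varepsilon}=H^1(\mathbb{R}^2;\mathbb{C}^2)$. Let $\Omega_+=(-\infty,0)\times\mathbb{R}$, $\Omega_-=(0,\infty)\times\mathbb{R}$, with normal $\nu=(1,0)$ pointing outwards of $\Omega_+$ (interchanging the two half-planes does not change the operator below), $u_\pm=u|_{\Omega_\pm}$, and let $\boldsymbol{t}_\Sigma^\pm:H^1(\Omega_\pm;\mathbb{C}^2)\to H^{1/2}(\Sigma;\mathbb{C}^2)$ be the Dirichlet traces. Then $H_{\widetilde V\delta_\Sigma}$ acts in $L^2(\mathbb{R}^2;\mathbb{C}^2)$ as $H_{\widetilde V\delta_\Sigma}u=(-i\sigma_1\partial_1-i\sigma_2\partial_2+m\sigma_3)u_+\oplus(-i\sigma_1\partial_1-i\sigma_2\partial_2+m\sigma_3)u_-$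 on the domain of all $u\in H^1(\Omega_+;\mathbb{C}^2)\oplus H^1(\Omega_-;\mathbb{C}^2)$ with $i\sigma_1(\boldsymbol{t}_\Sigma^+u_+-\boldsymbol{t}_\Sigma^-u_-)+\frac{\widetilde V}{2}(\boldsymbol{t}_\Sigma^+u_++\boldsymbol{t}_\Sigma^-u_-)=0$; it is self-adjoint since $\widetilde d\neq4$. Convention: $\mathrm{tanc}(w)=\tan(w)/w$ for $w\ne0$, $\mathrm{tanc}(0)=1$. *)

(* Defs.v *)
From HB Require Import structures.
From mathcomp Require Import all_boot all_order all_algebra.
From mathcomp Require Import all_classical all_reals all_analysis.
From mathcomp Require Import complex.

Set Implicit Arguments.
Unset Strict Implicit.
Unset Printing Implicit Defensive.

Import Order.TTheory GRing.Theory Num.Theory.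
Import numFieldNormedType.Exports.

Local Open Scope classical_set_scope.
Local Open Scope ring_scope.
Local Open Scope complex_scope.

(* Functions are ordinary functions compared almost
   everywhere; they take values in C^2 = 'cV[R[i]]_2, and a measure-theoretic or
   differential notion holds for such a function when it holds for the real and
   imaginary parts of both of its components. *)

Definition tanc {R : realType} (w : R) : R := if w == 0 then 1 else tan w / w.

Notation C2 R := 'cV[R[i]]_2.
Notation mR R := (measurableTypeR R).
Notation plane R := (mR R * mR R)%type.

Section Pauli.
Variable R : realType.

Definition sigma1 : 'M[R[i]]_2 :=
  \matrix_(i, j) if i == j then 0 else 1.

Definition sigma2 : 'M[R[i]]_2 :=
  \matrix_(i, j) if i == j then 0 else if i == 0 then - 'i%C else 'i%C.

Definition sigma3 : 'M[R[i]]_2 :=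
  \matrix_(i, j) if i == j then if i == 0 then 1 else - 1 else 0.

End Pauli.
Arguments sigma1 {R}.
Arguments sigma2 {R}.
Arguments sigma3 {R}.

Section SquareIntegrable.
Context {R : realType} {d : measure_display} {T : measurableType d}.
Variable mu : {measure set T -> \bar R}.

Definition reim1 (P : (T -> R) -> Prop) (u : T -> C2 R) : Prop :=
  forall k, P (fun x => complex.Re (u x k 0)) /\ P (fun x => complex.Im (u x k 0)).

Definition reim2 (P : (T -> R) -> (T -> R) -> Prop) (u v : T -> C2 R) : Prop :=
  forall k, P (fun x => complex.Re (u x k 0)) (fun x => complex.Re (v x k 0)) /\
            P (fun x => complex.Im (u x k 0)) (fun x => complex.Im (v x k 0)).

Definition euclid (v : C2 R) : R :=
  Num.sqrt (\sum_k (complex.Re (v k 0) ^+ 2 + complex.Im (v k 0) ^+ 2)).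

Definition L2norm (D : set T) (u : T -> C2 R) : \bar R :=
  ('N[mu]_2[(fun x => (\1_D x * euclid (u x))%:E)])%E.

Definition L2 (D : set T) (u : T -> C2 R) : Prop :=
  reim1 (fun f => measurable_fun D f) u /\ (L2norm D u < +oo)%E.

End SquareIntegrable.

Section Sobolev.
Variable R : realType.

Definition leb1 : {measure set (mR R) -> \bar R} := lebesgue_measure.
Definition leb2 : {measure set (plane R) -> \bar R} :=
  (lebesgue_measure \x lebesgue_measure)%E.

Definition dir (j : 'I_2) : R * R := if j == 0 then (1, 0) else (0, 1).

Fixpoint Ck (n : nat) (phi : R * R -> R) : Prop :=
  match n with
  | 0 => continuous phi
  | n'.+1 => forall j, (forall x, derivable phi x (dir j)) /\
                       Ck n' (fun x => 'D_(dir j) phi x)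
  end.

Definition test_function (D : set (R * R)) (phi : R * R -> R) : Prop :=
  [/\ forall n, Ck n phi,
      compact (closure [set x | phi x != 0]) &
      closure [set x | phi x != 0] `<=` D].

Definition weak_partial (D : set (plane R)) (j : 'I_2) (u g : plane R -> R) :=
  forall phi : R * R -> R, test_function D phi ->
    \int[leb2]_(x in D) (u x * 'D_(dir j) phi x) =
    - \int[leb2]_(x in D) (g x * phi x).

(* u belongs to H^1(D; C^2), with weak gradient (g 0, g 1); D is an open set. *)
Definition H1_grad (D : set (plane R)) (u : plane R -> C2 R)
    (g : 'I_2 -> plane R -> C2 R) : Prop :=
  L2 leb2 D u /\
  forall j, L2 leb2 D (g j) /\ reim2 (weak_partial D j) u (g j).

Definition partial (j : 'I_2) (u : plane R -> C2 R) (x : plane R) : C2 R :=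
  \col_k ('D_(dir j) (fun y : R * R => complex.Re (u y k 0)) x +i*
          'D_(dir j) (fun y : R * R => complex.Im (u y k 0)) x).

(* The Dirichlet trace on the line x_1 = 0 of a function of H^1(D), for D one of
   the two half-planes bounded by this line: the continuous extension to H^1(D)
   of the restriction map on C_c^oo(R^2), a dense subspace. Equality of traces
   in H^{1/2} is equality almost everywhere. *)
Definition is_trace (D : set (plane R)) (u : plane R -> C2 R)
    (t : mR R -> C2 R) : Prop :=
  L2 leb1 setT t /\
  exists (g : 'I_2 -> plane R -> C2 R) (phi : nat -> plane R -> C2 R),
    [/\ H1_grad D u g,
        forall n, reim1 (test_function setT) (phi n),
        L2norm leb2 D (fun x => phi n x - u x) @[n --> \oo] --> 0%E,
        forall j,
          L2norm leb2 D (fun x => partial j (phi n) x - g j x) @[n --> \oo]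
            --> 0%E &
        L2norm leb1 setT (fun s => phi n (0, s) - t s) @[n --> \oo] --> 0%E].

End Sobolev.
Arguments leb1 {R}.
Arguments leb2 {R}.

Section Operators.
Variable R : realType.

(* An unbounded operator in L^2(R^2; C^2) is given by its graph: T u f means
   u \in dom T and T u = f. *)
Definition operator := (plane R -> C2 R) -> (plane R -> C2 R) -> Prop.

Definition dirac_expr (m : R) (g : 'I_2 -> plane R -> C2 R)
    (u : plane R -> C2 R) (x : plane R) : C2 R :=
  - 'i%C *: (sigma1 *m g 0 x) - 'i%C *: (sigma2 *m g 1 x) + m%:C *: (sigma3 *m u x).

Definition dirac_potential (m : R) (W : plane R -> 'M[R[i]]_2) : operator :=
  fun u f => L2 leb2 setT f /\
    exists g, H1_grad setT u g /\
      {ae leb2, forall x, f x = dirac_expr m g u x + W x *m u x}.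

Definition localized (V : 'M[R[i]]_2) (eps : R) (x : plane R) : 'M[R[i]]_2 :=
  ((2 * eps)^-1 * \1_([set y : plane R | - eps < y.1 < eps]) x)%:C *: V.

Definition Omega_plus : set (plane R) := [set x | x.1 < 0].
Definition Omega_minus : set (plane R) := [set x | 0 < x.1].

Definition dirac_delta (m : R) (Vt : 'M[R[i]]_2) : operator :=
  fun u f => [/\ L2 leb2 setT u, L2 leb2 setT f &
    exists (gp gm : 'I_2 -> plane R -> C2 R) (tp tm : mR R -> C2 R),
      [/\ H1_grad Omega_plus u gp /\ H1_grad Omega_minus u gm,
          is_trace Omega_plus u tp /\ is_trace Omega_minus u tm,
          {ae leb1, forall s, 'i%C *: (sigma1 *m (tp s - tm s)) +
                              2^-1 *: (Vt *m (tp s + tm s)) = 0},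
          {ae leb2, forall x, Omega_plus x -> f x = dirac_expr m gp u x} &
          {ae leb2, forall x, Omega_minus x -> f x = dirac_expr m gm u x}]].

Definition opnorm (A : (plane R -> C2 R) -> (plane R -> C2 R)) : \bar R :=
  ereal_sup [set L2norm leb2 setT (A f) |
             f in [set f | L2 leb2 setT f /\ (L2norm leb2 setT f <= 1)%E]].

(* z is in the resolvent set of T, and S = (T - z)^{-1}. *)
Definition is_resolvent (T : operator) (z : R[i])
    (S : (plane R -> C2 R) -> (plane R -> C2 R)) : Prop :=
  [/\ forall f, L2 leb2 setT f ->
        L2 leb2 setT (S f) /\ T (S f) (fun x => f x + z *: S f x),
      forall u f, T u f -> {ae leb2, forall x, S (fun y => f y - z *: u y) x = u x} &
      (opnorm S < +oo)%E].

(* For self-adjoint operators, every non-real z is in all the resolvent sets,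
   and convergence for one non-real z is the same as for all of them. *)
Definition norm_resolvent_cvg (Te : R -> operator) (T : operator) : Prop :=
  exists2 z : R[i], complex.Im z != 0 &
  exists (Se : R -> (plane R -> C2 R) -> (plane R -> C2 R))
         (S : (plane R -> C2 R) -> (plane R -> C2 R)),
    [/\ forall eps, 0 < eps -> is_resolvent (Te eps) z (Se eps),
        is_resolvent T z S &
        opnorm (fun f x => Se eps f x - S f x) @[eps --> (0 : R)^'+] --> 0%E].

Definition interaction (eta tau : R) : 'M[R[i]]_2 :=
  (eta%:C)%:M + tau%:C *: sigma3.

End Operators.

(* Main.v *)
(* Write g = sqrt d / 2 > pi / 4. By the intermediate value theorem there is w
   in (pi / 4, pi / 2) with g sin (2 w) = w; put k = - g cos (2 w) > 0. Then the
   function h equal to 0 on (-oo, -1], to sin (w (1 + y)) on [-1, 1] and to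
   sin (2 w) e^(- k (y - 1)) on [1, +oo) solves
   h'(y) = - k h(y) + g 1_{|y| < 1} h(- y), and consequently
     (g h(- x1 / e), - i (eta + tau) / 2 h(x1 / e)) e^(i k x2 / e)
   is annihilated by the massless operator with potential V_e: for g > pi / 4 the
   potential binds modes whose momentum along Sigma has the order 1 / e.
   Cutting off in x2 and multiplying by N of order e^(- 1 / 2) gives u_e in the
   domain of H_{V_e} with |(H_{V_e} - z) u_e| <= 1.

   Norm resolvent convergence yields w_e in the domain of the limit operator with
   |u_e - w_e| -> 0 and (H - z) w_e = (H_{V_e} - z) u_e. Testing the difference of
   the two equations on {x1 > 0} against v, supported inside the strip
   {0 < x1 < e} so that the transmission condition plays no role, gives
     |int V_e u_e . v| = O(|u_e - w_e| e^(- 1 / 2)),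
   whereas for v oscillating like u_e the left-hand side has the order
   e^(- 1 / 2). *)

(* The profile comes from a reflection symmetry. Once the factor e^(i k x2 / e) is separated and x1
   = e y, the massless equation is a first-order system for two functions of y. Since the product of
   (eta + tau) / 2 and (eta - tau) / 2 is g^2, the reflection y -> - y exchanges its two equations
   up to constants, so one function h serves both components. For |y| < 1 it satisfies h'' = (k^2 -
   g^2) h, hence the sine; inserting the sine into the first-order equation gives the relations
   between g, w and k. For y < -1 the solutions of h' = - k h grow towards - oo, so h has to vanish
   there.

   Both sides of the final comparison have the same order in e. The potential gives 1 / e times an
   amplitude e^(- 1 / 2) times an area of order e. On the other side the derivatives moved onto v
   cost 1 / e, against the square root e^(1 / 2) of that area. Smallness can only come from |u_e -
   w_e|; its threshold [delta] does not depend on e, and a single e below 1 gives the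
   contradiction. *)
Require Import Defs.
From HB Require Import structures.
From mathcomp Require Import all_boot all_order all_algebra.
From mathcomp Require Import all_classical all_reals all_analysis.
From mathcomp Require Import measurable_realfun.
From mathcomp Require Import complex ring lra.

Set Implicit Arguments.
Unset Strict Implicit.
Unset Printing Implicit Defensive.

Import Order.TTheory GRing.Theory Num.Theory.
Import numFieldNormedType.Exports.

Local Open Scope ring_scope.
Local Open Scope classical_set_scope.
Local Open Scope complex_scope.

(** * Smooth functions *)

Section smooth.
Variable R : realType.
Implicit Types f g : R -> R.

(** The one-variable analogue of [Ck]. Classical derivatives in the plane are reached through tensor
    products and slices, so the calculus takes place on the line. *)
Fixpoint Cn (n : nat) f : Prop :=
  match n with
  | 0 => continuous f
  | n'.+1 => (forall x, derivable f x 1) /\ Cn n' f^`()%classic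
  end.

Definition smooth f := forall n, Cn n f.

Lemma Cn_continuous n f : Cn n f -> continuous f.
Proof.
case: n => // n [df _] x.
exact/differentiable_continuous/derivable1_diffP.
Qed.

Lemma CnS n f : Cn n.+1 f -> Cn n f.
Proof.
elim: n f => [f|n ih f [df /ih Cf]]; last by split.
exact: Cn_continuous.
Qed.

Lemma CnD n f g : Cn n f -> Cn n g -> Cn n (fun x => f x + g x).
Proof.
elim: n f g => [f g cf cg x|n ih f g [df Cf] [dg Cg]].
  exact: cvgD (cf x) (cg x).
split=> [x|]; first exact: derivableD.
rewrite (_ : (fun x => f x + g x)^`()%classic = fun x => f^`()%classic x + g^`()%classic x); first exact: ih.
by apply/funext => x; rewrite !derive1E deriveD.
Qed.

Lemma Cn_cst n c : Cn n (cst c : R -> R).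
Proof.
elim: n c => [c x|n ih c]; first exact: cvg_cst.
split=> [x|]; first exact: derivable_cst.
rewrite (_ : (cst c)^`()%classic = cst (0 : R)); first exact: ih.
by apply/funext => x; rewrite derive1_cst.
Qed.

Lemma CnM n f g : Cn n f -> Cn n g -> Cn n (fun x => f x * g x).
Proof.
elim: n f g => [f g cf cg x|n ih f g Cf1 Cg1].
  exact: cvgM (cf x) (cg x).
have [df Cf] := Cf1; have [dg Cg] := Cg1.
split=> [x|]; first exact: derivableM.
rewrite (_ : (fun x => f x * g x)^`()%classic = fun x => f x * g^`()%classic x + g x * f^`()%classic x).
  by apply: CnD; apply: ih => //; exact: CnS.
by apply/funext => x; rewrite !derive1E deriveM.
Qed.

Lemma is_derive_affine f (a b x df : R) : is_derive (a * x + b) 1 f df ->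
  is_derive x 1 (fun y => f (a * y + b)) (a * df).
Proof.
move=> fdf.
have da : is_derive x 1 (fun y : R => a * y + b) a.
  have := is_deriveD (is_deriveZ a (@is_derive_id _ _ x (1 : R))) (is_derive_cst b x (1 : R)).
  by rewrite addr0 /GRing.scale/= mulr1.
by apply: (is_derive_eq (is_derive1_comp (g := fun y => a * y + b) fdf da)); rewrite mulrC.
Qed.

Lemma Cn_affine n f a b : Cn n f -> Cn n (fun x => f (a * x + b)).
Proof.
elim: n f => [f cf x|n ih f [df Cf]].
  apply: (continuous_comp (f := fun x => a * x + b) (g := f)); last exact: cf.
  by apply: cvgD; [apply: cvgM; [exact: cvg_cst|exact: cvg_id]|exact: cvg_cst].
have d (x : R) : is_derive x 1 (fun y => f (a * y + b)) (a * f^`()%classic (a * x + b)).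
  by apply: is_derive_affine; rewrite derive1E; apply: DeriveDef.
split=> [x|]; first exact: ex_derive.
rewrite (_ : (_^`())%classic = fun x => a * f^`()%classic (a * x + b)).
  by apply: CnM; [exact: Cn_cst|exact: ih].
by apply/funext => x; rewrite derive1E derive_val.
Qed.

Lemma Cn_cos_sin n : Cn n (@cos R) /\ Cn n (@sin R).
Proof.
elim: n => [|n [ihc ihs]]; first by split; [exact: continuous_cos|exact: continuous_sin].
split; (split; first by move=> x; exact: ex_derive).
  rewrite (_ : (_^`())%classic = fun x => cst (-1) x * sin x).
    by apply: CnM => //; exact: Cn_cst.
  by apply/funext => x; rewrite derive1E derive_val mulN1r.
rewrite (_ : (_^`())%classic = @cos R) //.
by apply/funext => x; rewrite derive1E derive_val.
Qed.

Lemma Cn_const_mul n c f : Cn n f -> Cn n (fun x => c * f x).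
Proof. by move=> Cf; apply: CnM => //; exact: (Cn_cst n c). Qed.

Lemma is_derive_cvg f (x l : R) :
  h^-1 * (f (h + x) - f x) @[h --> 0^'] --> l -> is_derive x 1 f l.
Proof.
move=> fl.
have {}fl : h^-1 *: ((f \o shift x) (h *: 1) - f x) @[h --> 0^'] --> l.
  apply: cvg_trans fl; apply: near_eq_cvg; near=> h.
  by rewrite /GRing.scale/= mulr1.
by apply: DeriveDef; [apply/cvg_ex; exists l|exact: cvg_lim fl].
Unshelve. all: by end_near. Qed.

(** The bound forces f 0 = 0 and makes the difference quotient at most K |h|. This settles the one
    point near which [flat] is not given by a single formula. *)
Lemma is_derive0_quadratic f (K : R) : (forall t, `|f t| <= K * t ^+ 2) ->
  is_derive (0 : R) 1 f 0.
Proof.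
move=> fK; apply: is_derive_cvg.
have f0 : f 0 = 0.
  by apply/normr0_eq0/le_anti; rewrite normr_ge0 (le_trans (fK 0))// expr0n mulr0.
apply/norm_cvg0P; apply: (@squeeze_cvgr _ _ _ _ (cst 0) (fun h => K * `|h|)).
- near=> h; rewrite /cst normr_ge0/= addr0 f0 subr0 normrM normfV ler_pdivrMl.
    by apply: le_trans (fK h) _; rewrite [leRHS]mulrCA -expr2 real_normK ?num_real.
  by rewrite normr_gt0; near: h; exact: nbhs_dnbhs_neq.
- exact: cvg_cst.
- rewrite -[X in _ --> X](mulr0 K); apply: cvgM; first exact: cvg_cst.
  apply: cvg_trans (_ : `|h| @[h --> (0:R)] --> (0:R)).
    by apply: cvg_app; exact: cvg_within.
  by have := @norm_continuous R R^o 0; rewrite /continuous_at normr0.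
Unshelve. all: by end_near. Qed.

(** The powers of 1 / x make the family stable under differentiation up to linear combinations, so
    smoothness follows by induction on the order, for all n at once. *)
Definition flat (n : nat) (x : R) : R :=
  if 0 < x then x^-1 ^+ n * expR (- x^-1) else 0.

(** With s = 1 / x this reads s^(n + 2) e^(- s) <= (n + 2)^(n + 2), the power n + 2 of s / (n + 2)
    <= e^(s / (n + 2)). *)
Lemma flat_quadratic n x : `|flat n x| <= n.+2%:R ^+ n.+2 * x ^+ 2.
Proof.
rewrite /flat; case: ifPn => [x0|_]; last by rewrite normr0 mulr_ge0 ?sqr_ge0 ?exprn_ge0.
have s0 : 0 < x^-1 by rewrite invr_gt0.
rewrite ger0_norm ?mulr_ge0 ?exprn_ge0 ?expR_ge0 ?invr_ge0 ?(ltW x0)//.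
set s := x^-1 in s0 *.
have -> : x ^+ 2 = s ^- 2 by rewrite /s exprVn invrK.
rewrite ler_pdivlMr ?exprn_gt0// mulrAC -exprD addn2 expRN ler_pdivrMr ?expR_gt0//.
have -> : expR s = expR (s / n.+2%:R) ^+ n.+2.
  by rewrite -expRM_natl mulrC divfK// pnatr_eq0.
rewrite -exprMn; apply: lerXn2r; rewrite ?nnegrE ?(ltW s0) ?mulr_ge0 ?expR_ge0//.
rewrite -ler_pdivrMl ?ltr0n// mulrC.
by apply: le_trans (expR_ge1Dx _); rewrite lerDr.
Qed.

Lemma is_derive_flat n (x : R) :
  is_derive x 1 (flat n) (flat n.+2 x - n%:R * flat n.+1 x).
Proof.
have [x0|x0|->] := ltgtP x 0; last first.
- apply: (is_derive_eq (is_derive0_quadratic (flat_quadratic n))).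
  by rewrite /flat ltxx mulr0 subr0.
- apply: (near_eq_is_derive (f := fun y : R => y^-1 ^+ n * expR (- y^-1))).
    near=> y; rewrite /flat ifT//; near: y; exact: lt_nbhsr.
  have xN0 : x != 0 by rewrite gt_eqF.
  have dV : is_derive x 1 (fun y : R => y^-1) (- x ^- 2).
    apply: (is_derive_eq (is_deriveV xN0 (is_derive_id x (1 : R)))).
    by rewrite /GRing.scale/= mulr1.
  have := is_deriveX n dV; rewrite exprfctE => dX.
  have dE : is_derive x 1 (fun y : R => expR (- y^-1)) (expR (- x^-1) * (x ^- 2)).
    apply: (is_derive_eq (is_derive1_comp (g := fun y => - y^-1) (is_derive_expR _) (is_deriveN dV))).
    by rewrite opprK.
  apply: (is_derive_eq (is_deriveM dX dE)).
  rewrite /flat x0 /GRing.scale/= -!exprVn.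
  case: n {dX} => [|n] /=; first by rewrite mulr0n; ring.
  by move: (expR (- x^-1)) (n.+1%:R : R) (x^-1) => e k s; rewrite !exprS; ring.
- apply: (near_eq_is_derive (f := cst (0 : R))).
    near=> y; rewrite /flat ifF//; apply/negbTE; rewrite -leNgt ltW//.
    by near: y; exact: lt_nbhsl.
  apply: (is_derive_eq (is_derive_cst _ _ _)).
  by rewrite /flat ltNge (ltW x0)/= mulr0 subr0.
Unshelve. all: by end_near. Qed.

Lemma smooth_flat n : smooth (flat n).
Proof.
move=> k; elim: k n => [|k ih] n.
  move=> x; apply: differentiable_continuous; apply/derivable1_diffP.
  by have := is_derive_flat n x => ?; exact: ex_derive.
split=> [x|]; first by have := is_derive_flat n x => ?; exact: ex_derive.
rewrite (_ : (_^`())%classic = fun x => flat n.+2 x + (- n%:R) * flat n.+1 x).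
  by apply: CnD => //; exact: Cn_const_mul.
apply/funext => x; have ? := is_derive_flat n x.
by rewrite derive1E derive_val mulNr.
Qed.

(** The support [1/4, 3/4] stays strictly inside (0, 1): rescaled by e in the variable x1, the bump
    lives in {0 < x1 < e} without touching the interface. *)
Definition bumpR (x : R) : R := flat 0 (4 * x - 1) * flat 0 (3 - 4 * x).

Lemma smooth_bump : smooth bumpR.
Proof.
move=> n; apply: CnM.
  by have := Cn_affine 4 (-1) (smooth_flat 0 n).
rewrite (_ : (fun _ => _) = fun x => flat 0 (- 4 * x + 3)).
  exact: Cn_affine (smooth_flat 0 n).
by apply/funext => x; rewrite mulNr addrC.
Qed.

Lemma flat_ge0 n x : 0 <= flat n x.
Proof.
rewrite /flat; case: ifPn => // x0.
by rewrite mulr_ge0 ?expR_ge0 ?exprn_ge0 ?invr_ge0 ?ltW.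
Qed.

Lemma bump_ge0 x : 0 <= bumpR x.
Proof. by rewrite mulr_ge0 ?flat_ge0. Qed.

Lemma bump_le1 x : bumpR x <= 1.
Proof.
have f1 y : flat 0 y <= 1.
  rewrite /flat; case: ifPn => // y0; rewrite expr0 mul1r -expR0 ler_expR oppr_le0.
  by rewrite invr_ge0 ltW.
by rewrite mulr_ile1 ?flat_ge0.
Qed.

Lemma bump_out x : ~~ (4^-1 < x < 3 / 4) -> bumpR x = 0.
Proof.
rewrite /bumpR /flat; case: (ltP 0 (4 * x - 1)) => [h1|_ _]; last by rewrite mul0r.
case: (ltP 0 (3 - 4 * x)) => [h2|_ _]; last by rewrite mulr0.
by move=> /negP; case; apply/andP; split; lra.
Qed.

(** Both arguments of [flat] are at least 1/2 here, so each factor is at least e^(- 2). *)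
Lemma bump_ge x : 2 / 5 <= x <= 3 / 5 -> expR (- 4) <= bumpR x.
Proof.
move=> /andP[x1 x2]; rewrite /bumpR /flat !ifT; [|lra..].
rewrite !expr0 !mul1r -expRD ler_expR.
have h (y : R) : 2^-1 <= y -> y^-1 <= 2.
  by move=> hy; rewrite invf_ple ?posrE//; lra.
have h1 : (4 * x - 1)^-1 <= 2 by apply: h; lra.
have h2 : (3 - 4 * x)^-1 <= 2 by apply: h; lra.
lra.
Qed.

(** Parametrised by the coordinate itself and not by the increment from x, so that a partial
    derivative at x is an ordinary derivative at [proj j x]. *)
Definition slice (j : 'I_2) (F : R * R -> R) (x : R * R) (s : R) : R :=
  if j == 0 then F (s, x.2) else F (x.1, s).

Definition proj (j : 'I_2) (x : R * R) : R := if j == 0 then x.1 else x.2.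

Lemma slice_shift j F x (h : R) :
  (F \o shift x) (h *: dir R j) = (slice j F x \o shift (proj j x)) (h *: (1 : R)).
Proof.
rewrite /= /dir /slice /proj; case: ifP => _; congr F;
  apply: injective_projections => /=; rewrite /GRing.scale/= ?mulr0 ?add0r //.
Qed.

Lemma slice_proj j F x : slice j F x (proj j x) = F x.
Proof. by case: x => x1 x2; rewrite /slice /proj; case: (j == 0). Qed.

Lemma derivable_slice j F x :
  derivable F x (dir R j) = derivable (slice j F x) (proj j x) 1.
Proof.
rewrite /derivable slice_proj.
by under [in LHS]eq_fun do rewrite slice_shift.
Qed.

Lemma derive_slice j F x :
  'D_(dir R j) F x = 'D_1 (slice j F x) (proj j x).
Proof.
rewrite /derive slice_proj.
by under [in LHS]eq_fun do rewrite slice_shift.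
Qed.

Definition tensor f g (x : R * R) : R := f x.1 * g x.2.

Lemma slice_tensor j f g x : slice j (tensor f g) x =
  if j == 0 then (fun s => g x.2 * f s) else (fun s => f x.1 * g s).
Proof.
by rewrite /slice /tensor; case: ifP => // _; apply/funext => s; rewrite mulrC.
Qed.

Lemma tensor_derive j f g x : (forall s, derivable f s 1) ->
    (forall s, derivable g s 1) ->
  derivable (tensor f g) x (dir R j) /\
  'D_(dir R j) (tensor f g) x =
    if j == 0 then tensor (f^`())%classic g x else tensor f (g^`())%classic x.
Proof.
move=> df dg; rewrite derivable_slice derive_slice slice_tensor /proj /tensor.
case: ifP => _; rewrite -derive1E; split.
- exact: derivableZ.
- by rewrite !derive1E deriveZ// /GRing.scale/= mulrC.
- exact: derivableZ.
- by rewrite !derive1E deriveZ.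
Qed.

Lemma Ck_tensor n f g : smooth f -> smooth g -> Ck n (tensor f g).
Proof.
elim: n f g => [|n ih] f g sf sg /=.
  move=> x; apply: cvgM; apply: continuous_comp.
  - exact: cvg_fst.
  - exact: (Cn_continuous (sf 0%N)).
  - exact: cvg_snd.
  - exact: (Cn_continuous (sg 0%N)).
move=> j.
have df s : derivable f s 1 by case: (sf 1%N).
have dg s : derivable g s 1 by case: (sg 1%N).
have sf' : smooth (f^`())%classic by move=> k; case: (sf k.+1).
have sg' : smooth (g^`())%classic by move=> k; case: (sg k.+1).
split=> [x|]; first by case: (tensor_derive j x df dg).
have [j0|j0] := boolP (j == 0).
- rewrite (_ : (fun x => _) = tensor (f^`())%classic g); first exact: ih.
  by apply/funext => x; have [_ ->] := tensor_derive j x df dg; rewrite j0.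
- rewrite (_ : (fun x => _) = tensor f (g^`())%classic); first exact: ih.
  by apply/funext => x; have [_ ->] := tensor_derive j x df dg; rewrite (negbTE j0).
Qed.

Lemma test_function_tensor (D : set (R * R)) f g (a b c d : R) :
    smooth f -> smooth g ->
    (forall s, f s != 0 -> a <= s <= b) -> (forall s, g s != 0 -> c <= s <= d) ->
    (forall x, a <= x.1 <= b -> D x) ->
  test_function D (tensor f g).
Proof.
move=> sf sg fab gcd abD.
have sub : closure [set x | tensor f g x != 0] `<=` `[a, b]%classic `*` `[c, d]%classic.
  apply: subset_trans (_ : closure (`[a, b]%classic `*` `[c, d]%classic) `<=` _).
    apply: closure_subset => x /=; rewrite mulf_eq0 negb_or => /andP[fx gx].
    by rewrite !in_itv/=; split; [exact: fab|exact: gcd].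
  rewrite -(proj1 (closure_id _)) //; apply: compact_closed.
    exact: norm_hausdorff.
  by apply: compact_setX; exact: segment_compact.
split=> [n||].
- exact: Ck_tensor.
- apply: (subclosed_compact _ (compact_setX (@segment_compact R a b) (@segment_compact R c d)) sub).
  exact: closed_closure.
- by move=> x /sub[+ _]; rewrite /= in_itv/=; exact: abD.
Qed.

End smooth.

Lemma integrable_bounded d (T : measurableType d) (R : realType)
    (mu : {measure set T -> \bar R}) (D A : set T) (g : T -> R) (K : R) :
    measurable D -> measurable A -> (mu A < +oo)%E -> measurable_fun D g ->
    (forall x, D x -> `|g x| <= K * \1_A x) ->
  mu.-integrable D (EFin \o g).
Proof.
move=> mD mA Afin mg gK.
apply: (@le_integrable _ _ _ _ _ mD _ (fun x => K%:E * (\1_A x)%:E)%E).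
- exact/measurable_EFinP.
- move=> x Dx; rewrite /= lee_fin (le_trans (gK x Dx))// ler_norm//.
- apply: integrableZl => //; apply/integrableP; split.
    by apply/measurable_EFinP; exact: measurable_indic.
  under eq_integral do rewrite /= ger0_norm ?indicE//.
  rewrite integral_indic//; apply: le_lt_trans Afin.
  by apply: le_measure; rewrite ?inE//; exact: measurableI.
Qed.

(** * Measurability in the plane *)

Section plane_measurability.
Variable R : realType.

(** The sigma-algebra of the plane is the product one, so U has to be written as a countable union
    of measurable boxes, here with rational centres and radii 1 / (n + 1). *)
Lemma open_measurable_plane (U : set (R * R)) :
  open U -> measurable (U : set (plane R)).
Proof.
move=> oU.
pose box (i : rat * rat * nat) : set (plane R) :=
  ball (ratr i.1.1 : R) i.2.+1%:R^-1 `*` ball (ratr i.1.2 : R) i.2.+1%:R^-1.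
(* Codes of no box, and of boxes that leave U, contribute the empty set. *)
pose F n : set (plane R) := if (unpickle n : option (rat * rat * nat)) is Some i then
  if `[< box i `<=` U >] then box i else set0 else set0.
have -> : U = \bigcup_n F n.
  apply/seteqP; split => [[x1 x2] Ux|x [n _]]; last first.
    by rewrite /F; case: unpickle => // i; case: asboolP => // + ?; apply.
  have /nbhs_ballP[e /= e0 eU] : nbhs (x1, x2) U by exact: open_nbhs_nbhs.
  (* A box of radius r < e / 2 whose centre is within r of the point stays within distance e of the
     point. *)
  have [n ne] : exists n, n.+1%:R^-1 < e / 2.
    have e20 : 0 < e / 2 by rewrite divr_gt0.
    have [n _ nP] := near_infty_natSinv_lt (PosNum e20).
    by exists n; apply: nP => /=.
  have rat_near (x : R) : exists q : rat, `|ratr q - x| < n.+1%:R^-1.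
    have : x - n.+1%:R^-1 < x + n.+1%:R^-1 by rewrite ltrD2l gtrN.
    move=> /rat_in_itvoo[q]; rewrite in_itv/= => /andP[q1 q2].
    by exists q; rewrite ltr_distl q1.
  have [q1 q1P] := rat_near x1; have [q2 q2P] := rat_near x2.
  exists (pickle ((q1, q2, n) : rat * rat * nat)); first exact: I.
  rewrite /F pickleK; case: asboolP => [_|]; first by split.
  case=> -[y1 y2] [/= b1 b2]; apply: eU; rewrite /ball/=; split.
  - rewrite /ball/= in b1 *.
    rewrite (le_lt_trans (ler_distD (ratr q1) _ _))// distrC.
    by move: (ltrD q1P b1) ne; move: (n.+1%:R^-1 : R) => r; lra.
  - rewrite /ball/= in b2 *.
    rewrite (le_lt_trans (ler_distD (ratr q2) _ _))// distrC.
    by move: (ltrD q2P b2) ne; move: (n.+1%:R^-1 : R) => r; lra.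
apply: bigcupT_measurable => n; rewrite /F.
case: unpickle => // i; case: ifP => // _.
by apply: measurableX; apply: open_measurable; exact: ball_open.
Qed.

Lemma continuous_measurable_plane (f : R * R -> R) :
  continuous f -> measurable_fun setT (f : plane R -> mR R).
Proof.
move=> /continuousP cf; apply: (measurability _ (RGenOpens.measurableE R)).
move=> _ [_ [a [b ->] <-]]; rewrite setTI; apply: open_measurable_plane.
exact/cf/interval_open.
Qed.

Lemma measurable_tensor (f g : R -> R) : measurable_fun setT f ->
  measurable_fun setT g -> measurable_fun setT (tensor f g : plane R -> mR R).
Proof.
move=> mf mg; apply: measurable_funM.
  by apply: (measurableT_comp mf); exact: measurable_fst.
by apply: (measurableT_comp mg); exact: measurable_snd.
Qed.

Lemma leb2_box (A B : set R) : measurable A -> measurable B ->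
  leb2 (A `*` B) = (lebesgue_measure A * lebesgue_measure B)%E.
Proof. by move=> mA mB; rewrite /leb2/= product_measure1E. Qed.

End plane_measurability.

(** * Weak derivatives on the line *)

Section weak_derivative.
Variable R : realType.
Implicit Types f g psi : R -> R.
Notation mu := (@lebesgue_measure R).

Lemma lebesgue_itv_lty (a b : R) : (mu (`[a, b]%classic : set R) < +oo)%E.
Proof. by rewrite lebesgue_measure_itv/=; case: ifP => //; rewrite ltry. Qed.

Lemma compact_normr_bounded (T : topologicalType) (A : set T) (f : T -> R) :
  compact A -> {within A, continuous f} -> exists B : R, forall x, A x -> `|f x| <= B.
Proof.
move=> cA cf; have /compact_bounded[M [_ MP]] := continuous_compact cf cA.
by exists (M + 1) => x Ax; apply: (MP (M + 1)); [rewrite ltrDl|exists x].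
Qed.

Lemma CnS_derivable n (f : R -> R) : Cn n.+1 f -> forall x, derivable f x 1.
Proof. by case. Qed.

Lemma CnS_derive n (f : R -> R) : Cn n.+1 f -> Cn n (f^`())%classic.
Proof. by case. Qed.

Lemma Cn1_bounded psi (a b : R) : Cn 1 psi ->
  exists B : R, forall x, a <= x <= b -> `|psi x| <= B /\ `|(psi^`())%classic x| <= B.
Proof.
move=> C.
have [B1 HB1] := compact_normr_bounded (@segment_compact R a b)
  (continuous_subspaceT (Cn_continuous C)).
have [B2 HB2] := compact_normr_bounded (@segment_compact R a b)
  (continuous_subspaceT (Cn_continuous (CnS_derive C))).
exists (Num.max B1 B2) => x xab; rewrite !le_max HB1 ?HB2 ?orbT//=; rewrite in_itv//.
Qed.

(** Integration by parts with the boundary values of f itself: the terms at a common endpoint cancel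
    in [weak_on_cat], which is how continuity across a junction is expressed. *)
Definition weak_on (a b : R) (f f1 : R -> R) := forall psi, Cn 1 psi ->
  \int[mu]_(x in `[a, b]) (f x * (psi^`())%classic x + f1 x * psi x) =
  f b * psi b - f a * psi a.

Definition bounded_measurable f := measurable_fun setT f /\ exists B : R, forall x, `|f x| <= B.

Lemma weak_integrable (a b : R) (f f1 : R -> R) psi :
  bounded_measurable f -> bounded_measurable f1 -> Cn 1 psi ->
  mu.-integrable `[a, b] (EFin \o (fun x => f x * (psi^`())%classic x + f1 x * psi x)).
Proof.
move=> [mf [Bf fB]] [mf1 [Bf1 f1B]] C.
have [B BP] := Cn1_bounded a b C.
have B0 x : a <= x <= b -> 0 <= B by move=> /BP[+ _]; exact: le_trans.
apply: (@integrable_bounded _ _ R mu `[a, b]%classic `[a, b]%classic _ (Bf * B + Bf1 * B)) => //.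
- exact: lebesgue_itv_lty.
- apply: (measurable_funS measurableT) => //; apply: measurable_funD; apply: measurable_funM => //.
    exact: continuous_measurable_fun (Cn_continuous (CnS_derive C)).
  exact: continuous_measurable_fun (Cn_continuous C).
- move=> x /[dup] xab; rewrite /= in_itv/= => /BP[p1 p2].
  rewrite indicE mem_set// mulr1 (le_trans (ler_normD _ _))// !normrM lerD//; exact: ler_pM.
Qed.

(** The function f1 is compared with the derivative of g only in the open interval, because
    [dprofile] vanishes at -1 while the sine branch has slope w there. The endpoints are a null set
    and are taken out of the integral. *)
Lemma weak_on_Cn1 (a b : R) (f f1 : R -> R) g : a < b -> Cn 1 g ->
  bounded_measurable f -> bounded_measurable f1 ->
  (forall x, a <= x <= b -> f x = g x) ->
  (forall x, a < x < b -> f1 x = (g^`())%classic x) -> weak_on a b f f1.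
Proof.
move=> ab Cg bf bf1 fg f1g psi Cpsi.
have CM := CnM Cg Cpsi.
have dg x : derivable g x 1 by exact: CnS_derivable Cg _.
have dpsi x : derivable psi x 1 by exact: CnS_derivable Cpsi _.
pose h x := g x * (psi^`())%classic x + (g^`())%classic x * psi x.
have hE x : h x = ((fun x => g x * psi x)^`())%classic x.
  by rewrite !derive1E deriveM// /h !derive1E /GRing.scale/= [X in _ + X]mulrC.
have ch : continuous h by rewrite (funext hE); exact: Cn_continuous (CnS_derive CM).
have int1 := @weak_integrable a b f f1 psi bf bf1 Cpsi.
rewrite -Rintegral_itv_bndo_bndc; last first.
  by apply: integrableS int1 => //; exact: subset_itv_co_cc.
rewrite -Rintegral_itv_obnd_cbnd; last first.
  by apply: integrableS int1 => //; exact: subset_itv_oo_cc.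
transitivity (\int[mu]_(x in `]a, b[) h x).
  apply: eq_Rintegral => x; rewrite inE/= in_itv/= => /[dup] xab /andP[ax xb].
  by rewrite fg ?f1g// !ltW.
have inth : mu.-integrable `[a, b] (EFin \o h).
  by apply: continuous_compact_integrable; [exact: segment_compact|exact: continuous_subspaceT].
rewrite Rintegral_itv_obnd_cbnd; last first.
  by apply: integrableS inth => //; exact: subset_itv_oo_cc.
rewrite Rintegral_itv_bndo_bndc; last first.
  by apply: integrableS inth => //; exact: subset_itv_co_cc.
rewrite /Rintegral (@continuous_FTC2 _ h (fun x => g x * psi x)) //=.
- by rewrite !fg// ?lexx ?ltW.
- exact: continuous_subspaceT.
- split=> [x _||]; first exact: derivableM.
    by have := @Cn_continuous R _ _ CM a; exact: cvg_at_right_filter.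
  by have := @Cn_continuous R _ _ CM b; exact: cvg_at_left_filter.
Qed.

Lemma weak_on_cat (a b c : R) (f f1 : R -> R) : a <= c -> c <= b ->
  bounded_measurable f -> bounded_measurable f1 ->
  weak_on a c f f1 -> weak_on c b f f1 -> weak_on a b f f1.
Proof.
move=> ac cb bf bf1 wac wcb psi C.
have int1 := weak_integrable a b bf bf1 C.
have int2 := weak_integrable c b bf bf1 C.
have := Rintegral_itvB (x := c) int1; rewrite !bnd_simp => /(_ ac cb).
rewrite wac// Rintegral_itv_obnd_cbnd; last first.
  by apply: integrableS int2 => //; exact: subset_itv_oc_cc.
rewrite wcb//; lra.
Qed.

(** A single integral with values in the extended reals is the shape of the inner integral in
    Fubini's theorem. The slices of plane test functions are among the functions psi. *)
Definition weak (f f1 : R -> R) := forall psi M, Cn 1 psi -> (forall x, M <= `|x| -> psi x = 0) ->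
  (\int[mu]_x (f x * (psi^`())%classic x + f1 x * psi x)%:E = 0)%E.

(** The inequality is strict because the derivative at x depends on a neighbourhood of x. *)
Lemma derive1_out psi M : (forall x, M <= `|x| -> psi x = 0) ->
  forall x, M < `|x| -> (psi^`())%classic x = 0.
Proof.
move=> psi0 x Mx; rewrite derive1E.
rewrite (near_eq_derive (g := cst 0)) ?derive_cst//.
near=> y; apply: psi0; apply/ltW; near: y.
exact: (@norm_continuous R R^o x [set y | M < y] (lt_nbhsr Mx)).
Unshelve. all: by end_near. Qed.

Lemma weak_on_weak (M0 : R) (f f1 : R -> R) : bounded_measurable f -> bounded_measurable f1 ->
  (forall M, M0 < M -> weak_on (- M) M f f1) -> weak f f1.
Proof.
move=> bf bf1 wM psi M C psi0.
(* Positive and strictly above both M and M0: psi and its derivative vanish off [- N, N], and [wM]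
   applies to N. *)
pose N := `|M| + `|M0| + 1.
have MN : M < N by rewrite /N; have := ler_norm M; have := normr_ge0 M0; lra.
have N0 : 0 < N by rewrite /N; have := normr_ge0 M; have := normr_ge0 M0; lra.
have M0N : M0 < N by rewrite /N; have := ler_norm M0; have := normr_ge0 M; lra.
pose h x := f x * (psi^`())%classic x + f1 x * psi x.
have int1 : mu.-integrable `[- N, N] (EFin \o h) by exact: weak_integrable.
have hN : (fun x => (h x)%:E) = (EFin \o h) \_ `[- N, N].
  apply/funext => x; rewrite patchE; case: ifPn => //; rewrite notin_setE/= in_itv/=.
  move=> /negP; rewrite -ler_norml -ltNge => Nx.
  by rewrite /h (derive1_out psi0) ?psi0 ?mulr0 ?addr0// ?(ltW (lt_trans MN Nx))// (lt_trans MN Nx).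
rewrite -/h; transitivity ((\int[mu]_(x in `[- N, N]) h x)%:E).
  rewrite -[RHS]/(EFin (fine _)) fineK; last exact: integrable_fin_num.
  by rewrite [RHS]integral_mkcond -hN.
by rewrite wM// !psi0 ?mulr0 ?subrr// ?normrN gtr0_norm ?ltW.
Qed.

End weak_derivative.

Lemma continuous_pairl (R : realType) (c : R) : continuous (fun s : R => (s, c)).
Proof.
by move=> s; exact: (@cvg_pair _ _ _ (nbhs s) (nbhs s) (nbhs c) _ _ _
  (fun s => s) (fun=> c) cvg_id (cvg_cst _)).
Qed.

Lemma continuous_pairr (R : realType) (c : R) : continuous (fun s : R => (c, s)).
Proof.
by move=> s; exact: (@cvg_pair _ _ _ (nbhs s) (nbhs c) (nbhs s) _ _ _
  (fun=> c) (fun s => s) (cvg_cst _) cvg_id).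
Qed.

(** * Weak partial derivatives in the plane *)

Section weak_tensor.
Variable R : realType.
Notation mu := (@lebesgue_measure R).

Lemma test_functionW (D D' : set (R * R)) phi :
  D `<=` D' -> test_function D phi -> test_function D' phi.
Proof. by move=> DD' [? ? s]; split=> // x /s /DD'. Qed.

Lemma test_function_continuous D phi : @test_function R D phi -> continuous phi.
Proof. by case=> /(_ 0%N). Qed.

Lemma test_function_partial_continuous D phi (j : 'I_2) : @test_function R D phi ->
  continuous (fun x => 'D_(dir R j) phi x).
Proof. by case=> /(_ 1%N) /(_ j)[_]. Qed.

Lemma test_function_derivable D phi j x : @test_function R D phi ->
  derivable phi x (dir R j).
Proof. by case=> /(_ 1%N) /(_ j)[d _] _ _; exact: d. Qed.

Lemma test_function_out D phi x : @test_function R D phi -> ~ D x ->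
  phi x = 0 /\ forall j, 'D_(dir R j) phi x = 0.
Proof.
move=> [_ _ sD] nDx.
pose S := closure [set x | phi x != 0].
have nSx : (~` S) x by move=> /sD.
have out y : (~` S) y -> phi y = 0.
  by move=> nSy; apply/eqP; apply: contrapT => /negP phiy; apply: nSy; exact: subset_closure.
split=> [|j]; first exact: out.
rewrite (near_eq_derive (g := cst 0)) ?derive_cst//.
have : nbhs x (~` S).
  by apply: open_nbhs_nbhs; split=> //; exact/closed_openC/closed_closure.
by apply: filterS => y; exact: out.
Qed.

Lemma test_function_box D phi : @test_function R D phi -> exists M : R,
  forall x, ~ (`|x.1| < M /\ `|x.2| < M) ->
    phi x = 0 /\ forall j, 'D_(dir R j) phi x = 0.
Proof.
move=> tf.
have [_ cS _] := tf.
(* Taking the closed support of phi as the domain makes [test_function_out] give the vanishing of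
   the partial derivatives off the support as well. *)
have {}tf : test_function (closure [set x | phi x != 0]) phi by case: tf; split.
have [M [_ MP]] := compact_bounded cS.
exists (`|M| + 2) => x xM; apply: test_function_out tf _ => Sx; apply: xM.
have := MP (`|M| + 1) _ x Sx.
rewrite (le_lt_trans (ler_norm M)) ?ltrDl// => /(_ isT); rewrite /= prod_normE ge_max => /andP[p1 p2].
by split; lra.
Qed.

Lemma test_function_bounded D phi : @test_function R D phi -> exists B : R,
  forall x, `|phi x| <= B /\ forall j, `|'D_(dir R j) phi x| <= B.
Proof.
move=> tf.
have [M MP] := test_function_box tf.
have cK := compact_setX (@segment_compact R (- M) M) (@segment_compact R (- M) M).
have [B0 HB0] := compact_normr_bounded cK (continuous_subspaceT (test_function_continuous tf)).
have [B1 HB1] := compact_normr_bounded cK (continuous_subspaceT (test_function_partial_continuous (j := 0) tf)).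
have [B2 HB2] := compact_normr_bounded cK (continuous_subspaceT (test_function_partial_continuous (j := 1) tf)).
exists (`|B0| + `|B1| + `|B2|) => x.
have h0 := normr_ge0 B0; have h1 := normr_ge0 B1; have h2 := normr_ge0 B2.
have n0 := ler_norm B0; have n1 := ler_norm B1; have n2 := ler_norm B2.
have [[x1 x2]|/MP[-> D0]] := pselect (`|x.1| < M /\ `|x.2| < M); last first.
  by rewrite normr0; split=> [|j]; rewrite ?D0 ?normr0 ?addr_ge0.
have Kx : (`[- M, M] `*` `[- M, M]) x.
  by split; rewrite /= in_itv/= -ler_norml ltW.
split=> [|j]; first by have := HB0 x Kx; lra.
have [->|->] : j = 0 \/ j = 1.
  by case: j => -[|[|//]] ?; [left|right]; exact/val_inj.
  by have := HB1 x Kx; lra.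
by have := HB2 x Kx; lra.
Qed.

Lemma integrable_test (D D' : set (plane R)) (u phi : plane R -> R) (B : R) : measurable D ->
  measurable_fun D u -> (forall x, D x -> `|u x| <= B) -> test_function D' phi ->
  leb2.-integrable D (EFin \o (fun x => u x * phi x)) /\
  forall j, leb2.-integrable D (EFin \o (fun x => u x * 'D_(dir R j) (phi : R * R -> R) x)).
Proof.
move=> mD mu uB tf.
have [M MP] := test_function_box tf.
have [C CP] := test_function_bounded tf.
pose A : set (plane R) := `[- M, M]%classic `*` `[- M, M]%classic.
have mA : measurable A by apply: measurableX; exact: measurable_itv.
have Afin : (leb2 A < +oo)%E.
  by rewrite leb2_box//; apply: lte_mul_pinfty => //; rewrite ?ge0_fin_numE ?lebesgue_itv_lty.
have inA x : ~ A x -> ~ (`|x.1| < M /\ `|x.2| < M).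
  by move=> nA [x1 x2]; apply: nA; split; rewrite /= in_itv/= -ler_norml ltW.
split=> [|j].
- apply: (@integrable_bounded _ _ R leb2 D A _ (B * C)) => //.
    apply: measurable_funM => //; apply: measurable_funTS.
    exact: continuous_measurable_plane (test_function_continuous tf).
  move=> x Dx; rewrite indicE normrM; have [Ax|/inA /MP[-> _]] := pselect (A x).
    by rewrite mem_set// mulr1 ler_pM ?uB//; case: (CP x).
  by rewrite normr0 mulr0 !mulr_ge0// (le_trans (normr_ge0 _) (uB _ Dx), le_trans (normr_ge0 _) (proj1 (CP x))).
- apply: (@integrable_bounded _ _ R leb2 D A _ (B * C)) => //.
    apply: measurable_funM => //; apply: measurable_funTS.
    exact: continuous_measurable_plane (test_function_partial_continuous (j := j) tf).
  move=> x Dx; rewrite indicE normrM; have [Ax|/inA /MP[_ ->]] := pselect (A x).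
    by rewrite mem_set// mulr1 ler_pM ?uB//; case: (CP x).
  by rewrite normr0 mulr0 !mulr_ge0// (le_trans (normr_ge0 _) (uB _ Dx), le_trans (normr_ge0 _) (proj1 (CP x))).
Qed.

Lemma slice_Cn1 D phi j x : @test_function R D phi ->
  Cn 1 (slice j phi x) /\
  (slice j phi x)^`()%classic = slice j (fun y => 'D_(dir R j) phi y) x.
Proof.
move=> tf.
have d s : derivable (slice j phi x) s 1 /\
    'D_1 (slice j phi x) s = slice j (fun y => 'D_(dir R j) phi y) x s.
  pose y : R * R := if j == 0 then (s, x.2) else (x.1, s).
  have e1 : slice j phi y = slice j phi x by rewrite /slice /y; case: (j == 0).
  have e2 : proj j y = s by rewrite /proj /y; case: (j == 0).
  have := test_function_derivable (j := j) (x := y) tf; rewrite derivable_slice e1 e2.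
  move=> ?; split=> //; rewrite -e1 -{1}e2 -derive_slice /slice.
  by rewrite /y; case: (j == 0).
have E : (slice j phi x)^`()%classic = slice j (fun y => 'D_(dir R j) phi y) x.
  by apply/funext => s; rewrite derive1E; case: (d s).
split=> //; split=> [s|]; first by case: (d s).
rewrite E => s; rewrite /slice; have c := test_function_partial_continuous (j := j) tf.
case: (j == 0) c => c.
- exact: (@continuous_comp _ _ _ (fun s : R => (s, x.2)) (fun y => 'D_(dir R j) phi y) s
    (@continuous_pairl R x.2 s) (c _)).
- exact: (@continuous_comp _ _ _ (fun s : R => (x.1, s)) (fun y => 'D_(dir R j) phi y) s
    (@continuous_pairr R x.1 s) (c _)).
Qed.

(** By Fubini's theorem it suffices that the integral over x1 vanishes for every x2. There it is
    [weak f f1] tested against the slice of phi times the number e x2. *)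
Lemma weak_partial_tensor0 (f f1 e : R -> R) :
  bounded_measurable f -> bounded_measurable f1 -> bounded_measurable e ->
  weak f f1 -> weak_partial setT 0 (tensor f e) (tensor f1 e).
Proof.
move=> [mf [Bf fB]] [mf1 [Bf1 f1B]] [me [Be eB]] wf phi tf.
have U1 x : `|tensor f e x| <= Bf * Be by rewrite normrM ler_pM.
have U2 x : `|tensor f1 e x| <= Bf1 * Be by rewrite normrM ler_pM.
have [_ /(_ 0) I1] := integrable_test measurableT (measurable_tensor mf me) (fun x _ => U1 x) tf.
have [I2 _] := integrable_test measurableT (measurable_tensor mf1 me) (fun x _ => U2 x) tf.
have I12 := integrableD measurableT I1 I2.
apply/eqP; rewrite -addr_eq0 -RintegralD// /Rintegral.
rewrite -(integral21_prod_meas1 I12) integral0_eq//= => y _.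
have [C E] := slice_Cn1 0 (0, y) tf.
have [M MP] := test_function_box tf.
pose psi s := e y * slice 0 phi (0, y) s.
have dpsi : (psi^`())%classic = fun s => e y * slice 0 (fun x => 'D_(dir R 0) phi x) (0, y) s.
  apply/funext => s; rewrite -E !derive1E deriveZ//; exact: CnS_derivable C s.
have psi0 s : M <= `|s| -> psi s = 0.
  move=> Ms; rewrite /psi /slice/= (proj1 (MP _ _)) ?mulr0// => -[+ _].
  by rewrite ltNge Ms.
rewrite -(wf psi M (Cn_const_mul _ C) psi0); apply: eq_integral => x _.
by rewrite dpsi /psi /slice /tensor/=; congr EFin; ring.
Qed.

Lemma weak_partial_tensor1 (f f1 e : R -> R) :
  bounded_measurable f -> bounded_measurable f1 -> bounded_measurable e ->
  weak f f1 -> weak_partial setT 1 (tensor e f) (tensor e f1).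
Proof.
move=> [mf [Bf fB]] [mf1 [Bf1 f1B]] [me [Be eB]] wf phi tf.
have U1 x : `|tensor e f x| <= Be * Bf by rewrite normrM ler_pM.
have U2 x : `|tensor e f1 x| <= Be * Bf1 by rewrite normrM ler_pM.
have [_ /(_ 1) I1] := integrable_test measurableT (measurable_tensor me mf) (fun x _ => U1 x) tf.
have [I2 _] := integrable_test measurableT (measurable_tensor me mf1) (fun x _ => U2 x) tf.
have I12 := integrableD measurableT I1 I2.
apply/eqP; rewrite -addr_eq0 -RintegralD// /Rintegral.
rewrite -(integral12_prod_meas1 I12) integral0_eq//= => x _.
have [C E] := slice_Cn1 1 (x, 0) tf.
have [M MP] := test_function_box tf.
pose psi s := e x * slice 1 phi (x, 0) s.
have dpsi : (psi^`())%classic = fun s => e x * slice 1 (fun x => 'D_(dir R 1) phi x) (x, 0) s.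
  apply/funext => s; rewrite -E !derive1E deriveZ//; exact: CnS_derivable C s.
have psi0 s : M <= `|s| -> psi s = 0.
  move=> Ms; rewrite /psi /slice/= (proj1 (MP _ _)) ?mulr0// => -[_].
  by rewrite ltNge Ms.
rewrite -(wf psi M (Cn_const_mul _ C) psi0); apply: eq_integral => y _.
by rewrite dpsi /psi /slice /tensor/=; congr EFin; ring.
Qed.

End weak_tensor.

(** * Norms on C^2 and estimates in L^2 *)

Section euclid.
Variable R : realType.
Implicit Types v w : C2 R.

Lemma euclidE v : euclid v = Num.sqrt
  (complex.Re (v 0 0) ^+ 2 + complex.Im (v 0 0) ^+ 2 +
   (complex.Re (v 1 0) ^+ 2 + complex.Im (v 1 0) ^+ 2)).
Proof.
rewrite /euclid !big_ord_recl big_ord0 addr0.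
by rewrite (_ : lift ord0 ord0 = 1) //; exact/val_inj.
Qed.

Lemma ord2_cases (k : 'I_2) : k = 0 \/ k = 1.
Proof. by case: k => -[|[|//]] ?; [left|right]; exact/val_inj. Qed.

Lemma euclid_ge v k :
  `|complex.Re (v k 0)| <= euclid v /\ `|complex.Im (v k 0)| <= euclid v.
Proof.
have h (a b c d : R) : `|a| <= Num.sqrt (a ^+ 2 + b ^+ 2 + (c ^+ 2 + d ^+ 2)).
  rewrite -sqrtr_sqr ler_sqrt ?addr_ge0 ?sqr_ge0//.
  by have := sqr_ge0 b; have := sqr_ge0 c; have := sqr_ge0 d; lra.
rewrite euclidE; have [->|->] := ord2_cases k; split.
- exact: h.
- by rewrite [X in Num.sqrt (X + _)]addrC; exact: h.
- by rewrite addrC; exact: h.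
- by rewrite addrC [X in Num.sqrt (X + _)]addrC; exact: h.
Qed.

Lemma euclid_le v (B : R) : 0 <= B ->
  (forall k, `|complex.Re (v k 0)| <= B /\ `|complex.Im (v k 0)| <= B) ->
  euclid v <= 2 * B.
Proof.
move=> B0 vB; rewrite euclidE.
have B20 : 0 <= 2 * B by rewrite mulr_ge0.
rewrite -[leRHS](ger0_norm B20) -sqrtr_sqr ler_sqrt ?sqr_ge0//.
have h (a : R) : `|a| <= B -> a ^+ 2 <= B ^+ 2.
  by move=> aB; rewrite -(real_normK (num_real a)) lerXn2r ?nnegrE.
have [/h h1 /h h2] := vB 0; have [/h h3 /h h4] := vB 1.
rewrite exprMn; lra.
Qed.

Lemma euclid_ge0 v : 0 <= euclid v.
Proof. exact: sqrtr_ge0. Qed.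

End euclid.

Section L2_bounds.
Context {R : realType} {d : measure_display} {T : measurableType d}.
Variable mu : {measure set T -> \bar R}.
Implicit Types (D A : set T) (u : T -> C2 R).

Lemma measurable_euclid D u : reim1 (fun f => measurable_fun D f) u ->
  measurable_fun D (fun x => euclid (u x)).
Proof.
move=> mu_.
rewrite (_ : (fun x => _) = Num.sqrt \o (fun x => complex.Re (u x 0 0) ^+ 2 +
   complex.Im (u x 0 0) ^+ 2 + (complex.Re (u x 1 0) ^+ 2 + complex.Im (u x 1 0) ^+ 2))).
  apply: (@measurableT_comp _ _ _ _ _ _ (@Num.sqrt R)).
    by apply: continuous_measurable_fun => x; exact: sqrt_continuous.
  by repeat apply: measurable_funD; apply: measurable_funX; case: (mu_ 0); case: (mu_ 1).
by apply/funext => x /=; rewrite euclidE.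
Qed.

Lemma measurable_euclid_indic D u : measurable D ->
    reim1 (fun f => measurable_fun D f) u ->
  measurable_fun setT (fun x => \1_D x * euclid (u x)).
Proof.
move=> mD /measurable_euclid mu_.
rewrite (_ : (fun x => _) = (fun x => euclid (u x)) \_ D).
  by apply/(measurable_restrict _ mD measurableT); rewrite setTI.
by apply/funext => x; rewrite patchE indicE; case: ifP => _; rewrite ?mul1r ?mul0r.
Qed.

Lemma Lnorm2E (f : T -> R) :
  'N[mu]_2[EFin \o f]%E = ((\int[mu]_x (f x ^+ 2)%:E) `^ 2^-1)%E.
Proof.
rewrite unlock; congr (_ `^ _)%E; apply: eq_integral => x _ /=.
by rewrite powR_mulrn// real_normK ?num_real.
Qed.

Lemma L2norm_le u (G : T -> R) (K I : R) : 0 <= K -> 0 <= I ->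
    (forall x, euclid (u x) <= K * G x) -> reim1 (fun f => measurable_fun setT f) u ->
    measurable_fun setT G -> (\int[mu]_x (G x ^+ 2)%:E <= (I ^+ 2)%:E)%E ->
  (L2norm mu setT u <= (K * I)%:E)%E.
Proof.
move=> K0 I0 uG mu_ mG GI.
have m1 := measurable_euclid_indic measurableT mu_.
rewrite /L2norm Lnorm2E.
apply: (@le_trans _ _ ((((K * I) ^+ 2)%:E) `^ 2^-1)%E); last first.
  rewrite poweR_EFin -powR_mulrn ?mulr_ge0// -powRrM mulfV ?pnatr_eq0//.
  by rewrite powRr1 ?mulr_ge0.
have int0 : (0 <= \int[mu]_x ((\1_setT x * euclid (u x)) ^+ 2)%:E)%E.
  by apply: integral_ge0 => x _; rewrite lee_fin sqr_ge0.
apply: gt0_ler_poweR; rewrite ?invr_ge0// ?in_itv/= ?int0 ?leey ?lee_fin ?sqr_ge0//.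
apply: (@le_trans _ _ (\int[mu]_x ((K ^+ 2)%:E * (G x ^+ 2)%:E))%E).
  apply: ge0_le_integral => //.
  - by move=> x _; rewrite lee_fin sqr_ge0.
  - by apply/measurable_EFinP; apply: measurable_funX.
  - apply/measurable_EFinP; apply: measurable_funM => //; exact: measurable_funX.
  - move=> x _; rewrite -EFinM lee_fin indicE in_setT mul1r -exprMn.
    by rewrite lerXn2r ?nnegrE ?euclid_ge0// (le_trans (euclid_ge0 (u x))).
rewrite ge0_integralZl//.
- by rewrite (exprMn _ K) [leRHS]EFinM lee_wpmul2l// lee_fin sqr_ge0.
- by apply/measurable_EFinP; exact: measurable_funX.
- by move=> x _; rewrite lee_fin sqr_ge0.
- by rewrite lee_fin sqr_ge0.
Qed.

Lemma L2norm_ae u v : reim1 (fun f => measurable_fun setT f) u ->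
    reim1 (fun f => measurable_fun setT f) v -> {ae mu, forall x, u x = v x} ->
  L2norm mu setT u = L2norm mu setT v.
Proof.
move=> mu_ mv uv; rewrite /L2norm !Lnorm2E; congr (_ `^ _)%E.
apply: ae_eq_integral => //.
- by apply/measurable_EFinP; apply: measurable_funX; exact: measurable_euclid_indic.
- by apply/measurable_EFinP; apply: measurable_funX; exact: measurable_euclid_indic.
- by apply: filterS uv => x -> _.
Qed.

(** Hoelder's inequality for u and the indicator of A, whose L^2 norm is s. Here f stands for a real
    component of u, and D' may exceed D so that a norm over the whole plane controls an integral
    over the half-plane. *)
Lemma L2norm_pairing D D' A u (f phi : T -> R) (K n s : R) :
    measurable D -> measurable D' -> measurable A -> D `<=` D' ->
    mu A = (s ^+ 2)%:E -> 0 <= s -> 0 <= K ->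
    reim1 (fun f => measurable_fun D' f) u -> (L2norm mu D' u <= n%:E)%E ->
    measurable_fun D f -> (forall x, D x -> `|f x| <= euclid (u x)) ->
    measurable_fun D phi -> (forall x, D x -> `|phi x| <= K * \1_A x) ->
  mu.-integrable D (EFin \o (fun x => f x * phi x)) /\
  `|\int[mu]_(x in D) (f x * phi x)| <= n * K * s.
Proof.
move=> mD mD' mA DD' muA s0 K0 mu_ un mf fu mphi phiK.
have m1 := measurable_euclid_indic mD' mu_.
have mfphi : measurable_fun D (fun x => f x * phi x) by exact: measurable_funM.
have mi : measurable_fun setT (\1_A : T -> R) by exact: measurable_indic.
have NA : 'N[mu]_2[EFin \o \1_A]%E = s%:E.
  rewrite Lnorm2E (_ : (\int[mu]_x _)%E = (s ^+ 2)%:E).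
    rewrite poweR_EFin -powR_mulrn// -powRrM mulfV ?pnatr_eq0//.
    by rewrite powRr1.
  transitivity (\int[mu]_x (\1_A x)%:E)%E; last by rewrite integral_indic// setIT.
  by apply: eq_integral => x _; rewrite indicE; case: (x \in A); rewrite ?expr1n ?expr0n.
have bound : (\int[mu]_(x in D) `|(f x * phi x)%:E| <= (n * K * s)%:E)%E.
  apply: (@le_trans _ _ (\int[mu]_x (K%:E * `|(\1_D' x * euclid (u x) * \1_A x)%:E|))%E).
    rewrite integral_mkcond; apply: ge0_le_integral => //.
    - by move=> x _; rewrite patchE; case: ifP.
    - apply/(measurable_restrict _ mD measurableT); rewrite setTI.
      by apply: measurableT_comp => //; exact/measurable_EFinP.
    - apply: measurable_funeM; apply: measurableT_comp => //.
      by apply/measurable_EFinP; exact: measurable_funM.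
    - move=> x _; rewrite patchE; case: ifPn => [|_]; last by rewrite mule_ge0.
      rewrite inE => Dx; rewrite -EFinM lee_fin normrM.
      rewrite [\1_D' x]indicE mem_set ?mul1r; last exact: DD'.
      rewrite [`|euclid _ * _|]ger0_norm ?mulr_ge0 ?euclid_ge0// mulrCA.
      by rewrite ler_pM ?fu ?phiK.
  rewrite ge0_integralZl//; last first.
    by apply: measurableT_comp => //; apply/measurable_EFinP; exact: measurable_funM.
  have two : (2^-1 + 2^-1 = 1 :> R) by lra.
  have := @hoelder _ _ _ mu _ _ 2 2 m1 mi (ltr0Sn _ _) (ltr0Sn _ _) two.
  rewrite NA Lnorm1 => H.
  rewrite (mulrC n) -mulrA EFinM lee_wpmul2l ?lee_fin//.
  by apply: le_trans H _; rewrite EFinM lee_wpmul2r// lee_fin.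
have ifp : mu.-integrable D (EFin \o (fun x => f x * phi x)).
  apply/integrableP; split; first exact/measurable_EFinP.
  by apply: le_lt_trans bound _; rewrite ltry.
split=> //; apply: le_trans (le_normr_Rintegral mD ifp) _.
rewrite -lee_fin; apply: le_trans bound; rewrite /Rintegral fineK//.
by have /integrable_abse/integrable_fin_num := ifp; apply.
Qed.

End L2_bounds.

Lemma Cn_expR (R : realType) n : Cn n (@expR R).
Proof.
elim: n => [|n ih]; first exact: continuous_expR.
split=> [x|]; first exact: ex_derive.
rewrite (_ : (_^`())%classic = @expR R) //.
by apply/funext => x; rewrite derive1E derive_val.
Qed.

(** The function g sin (2 w) - w is g - pi / 4 > 0 at pi / 4 and - pi / 2 at pi / 2. On the open
    interval between them cos (2 w) is negative, which will make k positive. *)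
Lemma exists_omega (R : realType) (g : R) : pi / 4 < g ->
  exists2 w, pi / 4 < w < pi / 2 & g * sin (2 * w) = w.
Proof.
move=> hg; have pi0 := @pi_gt0 R.
pose f w := g * sin (2 * w) - w.
have e1 : 2 * (pi / 4) = pi / 2 :> R by field.
have e2 : 2 * (pi / 2) = pi :> R by field.
have f1 : f (pi / 4) = g - pi / 4 by rewrite /f e1 sin_pihalf mulr1.
have f2 : f (pi / 2) = - (pi / 2) by rewrite /f e2 sinpi mulr0 sub0r.
have cf : continuous f.
  move=> x; apply: cvgB; last exact: cvg_id.
  apply: cvgM; first exact: cvg_cst.
  apply: (@continuous_comp _ _ _ (fun w : R => 2 * w) (@sin R)); last exact: continuous_sin.
  by apply: cvgM; [exact: cvg_cst|exact: cvg_id].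
have le42 : pi / 4 <= pi / 2 :> R by lra.
have [|w] := IVT (v := 0) le42 (continuous_subspaceT cf).
  by rewrite f1 f2 ge_min le_max; apply/andP; split; apply/orP; [right|left]; lra.
rewrite in_itv/= => /andP[w1 w2] fw; exists w; last by move: fw; rewrite /f; lra.
rewrite !lt_neqAle w1 w2 !andbT; apply/andP; split.
  by apply/eqP => wE; move: fw; rewrite -wE f1; lra.
by apply/eqP => wE; move: fw; rewrite wE f2; lra.
Qed.

(** * The transverse profile *)

Section profile.
Variables (R : realType) (g w k : R).
Implicit Types a b c x y : R.
Hypothesis w_itv : pi / 4 < w < pi / 2.
Hypothesis gw : g * sin (2 * w) = w.
Hypothesis kE : k = - g * cos (2 * w).
Notation mu := (@lebesgue_measure R).

Lemma sin2w_gt0 : 0 < sin (2 * w).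
Proof. by apply: sin_gt0_pi; move: w_itv => /andP[w1 w2]; have := @pi_gt0 R; lra. Qed.

Lemma w_gt0 : 0 < w.
Proof. by move: w_itv => /andP[w1 w2]; have := @pi_gt0 R; lra. Qed.

Lemma g_gt0 : 0 < g.
Proof. by rewrite -(pmulr_lgt0 _ sin2w_gt0) gw w_gt0. Qed.

Lemma k_gt0 : 0 < k.
Proof.
rewrite kE mulNr -mulrN; apply: mulr_gt0 g_gt0 _.
by rewrite -sinBpihalf; apply: sin_gt0_pihalf; move: w_itv => /andP[w1 w2]; lra.
Qed.

Definition profile (y : R) : R :=
  if y <= -1 then 0 else if y <= 1 then sin (w * (1 + y))
  else sin (2 * w) * expR (- k * (y - 1)).

(** The right-hand side of the differential equation is taken as the definition, so the equation
    holds at every point. What has to be proved is that this is the weak derivative; the profile has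
    a corner at -1. *)
Definition dprofile (y : R) : R :=
  - k * profile y + (if -1 < y < 1 then g * profile (- y) else 0).

Lemma profile_left y : y <= -1 -> profile y = 0.
Proof. by rewrite /profile => ->. Qed.

Lemma profile_mid y : -1 <= y <= 1 -> profile y = sin (w * (1 + y)).
Proof.
rewrite /profile => /andP[y1 ->]; case: ifPn => // y2.
have -> : y = -1 by lra.
by rewrite subrr mulr0 sin0.
Qed.

Lemma profile_right y : 1 <= y -> profile y = sin (2 * w) * expR (- k * (y - 1)).
Proof.
move=> y1; rewrite /profile ifF; last by apply/negbTE; rewrite -ltNge; lra.
case: ifPn => // y2.
have -> : y = 1 by lra.
by rewrite subrr mulr0 expR0 mulr1; congr sin; ring.
Qed.

(** The factor e^k pays for the interval [-1, 1], where |sin| <= 1 <= e^(k (1 - |y|)); on the right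
    it appears by itself in e^(- k (y - 1)). *)
Lemma profile_bound y : `|profile y| <= expR k * expR (- k * `|y|).
Proof.
have k0 := ltW k_gt0; have s1 (x : R) : `|sin x| <= 1 by exact: sin_max.
have [y1|y1] := leP y (-1).
  by rewrite profile_left// normr0 mulr_ge0 ?expR_ge0.
have [y2|y2] := leP y 1.
  rewrite profile_mid ?y2 ?(ltW y1)// (le_trans (s1 _))// -expRD -[leLHS]expR0 ler_expR.
  have : `|y| <= 1 by rewrite ler_norml y2 ltW.
  by move=> ?; rewrite -[X in X + _]mulr1 mulNr -mulrBr mulr_ge0//; lra.
rewrite (profile_right (ltW y2)) normrM (ger0_norm (expR_ge0 _)) ger0_norm; last first.
  by rewrite ltW// sin2w_gt0.
rewrite (ger0_norm (_ : 0 <= y)); last by lra.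
rewrite -expRD (_ : k + - k * y = - k * (y - 1)); last by ring.
by rewrite ler_piMl ?expR_ge0// (le_trans (ler_norm _) (s1 _)).
Qed.

Lemma profile_le y : `|profile y| <= expR k.
Proof.
apply: le_trans (profile_bound y) _; rewrite ler_piMr ?expR_ge0//.
by rewrite -[leRHS]expR0 ler_expR mulNr oppr_le0 mulr_ge0// ltW// k_gt0.
Qed.

Lemma measurable_profile : measurable_fun setT profile.
Proof.
have maff (a b : R) : measurable_fun setT (fun y : R => a * y + b).
  by apply: measurable_funD => //; exact: measurable_funM.
apply: measurable_fun_ifT.
- by apply: measurable_fun_ler.
- by [].
- apply: measurable_fun_ifT.
  + by apply: measurable_fun_ler.
  + rewrite (_ : (fun _ => _) = (@sin R) \o (fun y => w * y + w)).
      apply: measurableT_comp => //; exact: continuous_measurable_fun (@continuous_sin R).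
    by apply/funext => y /=; congr sin; ring.
  + apply: measurable_funM => //.
    rewrite (_ : (fun _ => _) = (@expR R) \o (fun y => (- k) * y + k)).
      by apply: measurableT_comp.
    by apply/funext => y /=; congr expR; ring.
Qed.

Lemma bounded_measurable_profile c : bounded_measurable (fun x => profile (c * x)).
Proof.
split; last by exists (expR k) => x; exact: profile_le.
by apply: measurableT_comp => //; exact: measurable_profile.
Qed.

Lemma bounded_measurable_dprofile c : bounded_measurable (fun x => c * dprofile (c * x)).
Proof.
have mc : measurable_fun setT (fun x : R => c * x) by exact: measurable_funM.
split.
  apply: measurable_funM => //; apply: (measurableT_comp (f := dprofile)) => //.
  apply: measurable_funD; first by apply: measurable_funM => //; exact: measurable_profile.
  apply: measurable_fun_ifT => //.
    by apply: measurable_and; exact: measurable_fun_ltr.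
  apply: measurable_funM => //.
  by apply: measurableT_comp => //; exact: measurable_profile.
exists (`|c| * (k * expR k + g * expR k)) => x; rewrite normrM ler_wpM2l//.
have k0 := ltW k_gt0; have g0 := ltW g_gt0.
rewrite (le_trans (ler_normD _ _))// lerD//.
  by rewrite normrM normrN (ger0_norm k0) ler_wpM2l// profile_le.
case: ifP => _; last by rewrite normr0 mulr_ge0 ?expR_ge0.
by rewrite normrM (ger0_norm g0) ler_wpM2l// profile_le.
Qed.

Let bm := bounded_measurable_profile.
Let bdm := bounded_measurable_dprofile.

Lemma weak_on_profile_left a b c : a < b -> (forall x, a <= x <= b -> c * x <= -1) ->
  weak_on a b (fun x => profile (c * x)) (fun x => c * dprofile (c * x)).
Proof.
move=> ab h; apply: (weak_on_Cn1 ab (Cn_cst 1 0) (bm c) (bdm c)).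
  by move=> x /h; exact: profile_left.
move=> x /andP[ax xb]; rewrite derive1_cst /dprofile.
have cx : c * x <= -1 by apply: h; rewrite !ltW.
by rewrite profile_left// ifF ?mulr0 ?addr0 ?mulr0//; apply/negbTE/negP => /andP[]; lra.
Qed.

Lemma weak_on_profile_right a b c : a < b -> (forall x, a <= x <= b -> 1 <= c * x) ->
  weak_on a b (fun x => profile (c * x)) (fun x => c * dprofile (c * x)).
Proof.
move=> ab h.
pose G x := sin (2 * w) * expR ((- k * c) * x + k).
have CG : Cn 1 G by apply: Cn_const_mul; exact: Cn_affine (Cn_expR R 1).
have GE x : 1 <= c * x -> profile (c * x) = G x.
  by move=> /profile_right ->; congr (_ * expR _); ring.
apply: (weak_on_Cn1 ab CG (bm c) (bdm c)); first by move=> x /h; exact: GE.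
move=> x /andP[ax xb].
have cx : 1 <= c * x by apply: h; rewrite !ltW.
have dG : is_derive x 1 G (sin (2 * w) * ((- k * c) * expR (- k * c * x + k))).
  exact: is_deriveZ (is_derive_affine (is_derive_expR _)).
rewrite derive1E derive_val /dprofile ifF; last by apply/negbTE/negP => /andP[]; lra.
by rewrite GE// /G; ring.
Qed.

Lemma weak_on_profile_mid a b c : a < b -> (forall x, a <= x <= b -> -1 <= c * x <= 1) ->
  (forall x, a < x < b -> -1 < c * x < 1) ->
  weak_on a b (fun x => profile (c * x)) (fun x => c * dprofile (c * x)).
Proof.
move=> ab h h'.
pose G x := sin ((w * c) * x + w).
have CG : Cn 1 G by exact: Cn_affine (proj2 (Cn_cos_sin R 1)).
have GE x : w * (1 + c * x) = (w * c) * x + w by ring.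
apply: (weak_on_Cn1 ab CG (bm c) (bdm c)).
  by move=> x /h /profile_mid ->; rewrite GE.
move=> x xab; have := h' x xab => /andP[c1 c2].
have dG : is_derive x 1 G ((w * c) * cos ((w * c) * x + w)).
  exact: is_derive_affine (is_derive_sin _).
rewrite derive1E derive_val /dprofile c1 c2/= !profile_mid ?ltW ?(ltW c1) ?(ltW c2)//; [|lra..].
rewrite GE; set s := _ + w.
(* By [gw] and [kE] the addition formula gives g sin (2 w - s) = w cos s + k sin s. The last term
   cancels against - k sin s and leaves the derivative of the sine. *)
rewrite (_ : w * (1 + - (c * x)) = 2 * w - s); last by rewrite /s; ring.
rewrite sinB mulrBr (mulrA g) gw kE -mulrA; ring.
Qed.

(** Both signs of c occur, since [amp0] is a reflected profile. The junctions are at 1 / |c| and - 1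
    / |c| in either case, but for c < 0 the three branches follow one another in the opposite
    order. *)
Lemma weak_profile c : c != 0 ->
  weak (fun x => profile (c * x)) (fun x => c * dprofile (c * x)).
Proof.
move=> c0; apply: (weak_on_weak (M0 := `|c|^-1) (bm c) (bdm c)) => M cM.
have ac0 : 0 < `|c| by rewrite normr_gt0.
pose r := `|c|^-1; have r0 : 0 < r by rewrite invr_gt0.
have cr : `|c| * r = 1 by rewrite mulfV// gt_eqF.
have lo x : x <= - r -> `|c| * x <= -1.
  by move=> xr; rewrite -cr -mulrN ler_pM2l.
have hi x : r <= x -> 1 <= `|c| * x.
  by move=> xr; rewrite -cr ler_pM2l.
have mi x : - r <= x <= r -> -1 <= `|c| * x <= 1.
  by move=> /andP[x1 x2]; rewrite -cr -mulrN !ler_pM2l// x1.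
have mi' x : - r < x < r -> -1 < `|c| * x < 1.
  by move=> /andP[x1 x2]; rewrite -cr -mulrN !ltr_pM2l// x1.
have rM : r < M by [].
apply: (weak_on_cat (c := r) _ _ (bm c) (bdm c)); [lra|lra| |].
  apply: (weak_on_cat (c := - r) _ _ (bm c) (bdm c)); [lra|lra| |].
  - have [cp|cn] := leP 0 c.
      apply: weak_on_profile_left; first lra.
      by move=> x /andP[_ xr]; have := lo x xr; rewrite ger0_norm.
    apply: weak_on_profile_right; first lra.
    by move=> x /andP[_ xr]; have := lo x xr; rewrite ltr0_norm// mulNr; lra.
  - apply: weak_on_profile_mid; first lra.
      move=> x /mi; have [cp|cn] := leP 0 c; first by rewrite ger0_norm.
      by rewrite ltr0_norm// mulNr; lra.
    move=> x /mi'; have [cp|cn] := leP 0 c; first by rewrite ger0_norm.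
    by rewrite ltr0_norm// mulNr; lra.
have [cp|cn] := leP 0 c.
  apply: weak_on_profile_right; first lra.
  by move=> x /andP[xr _]; have := hi x xr; rewrite ger0_norm.
apply: weak_on_profile_left; first lra.
by move=> x /andP[xr _]; have := hi x xr; rewrite ltr0_norm// mulNr; lra.
Qed.

(** The argument w (1 - y) lies between 2 w / 5 and 3 w / 5, hence below pi / 2, where the sine
    increases. *)
Lemma profileN_ge y : 2 / 5 <= y <= 3 / 5 -> sin (w * (2 / 5)) <= profile (- y).
Proof.
move=> /andP[y1 y2]; rewrite profile_mid; last by apply/andP; split; lra.
have w0 := w_gt0; have /andP[_ w2] := w_itv; have pi0 := @pi_gt0 R.
have l : w * (2 / 5) <= w * (1 - y) by apply: (ler_wpM2l (ltW w0)); lra.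
have u : w * (1 - y) <= w * (3 / 5) by apply: (ler_wpM2l (ltW w0)); lra.
have p : 0 <= w * (2 / 5) by apply: (mulr_ge0 (ltW w0)); lra.
by rewrite leNgt ltr_sin ?in_itv/= -?leNgt//; apply/andP; split; lra.
Qed.

Lemma profileN_ge0 y : 0 <= y <= 1 -> 0 <= profile (- y).
Proof.
move=> /andP[y1 y2]; rewrite profile_mid; last by apply/andP; split; lra.
have w0 := w_gt0; have /andP[_ w2] := w_itv; have pi0 := @pi_gt0 R.
have l : w * (1 - y) <= w * 1 by apply: (ler_wpM2l (ltW w0)); lra.
have p : 0 <= w * (1 - y) by apply: (mulr_ge0 (ltW w0)); lra.
by apply: sin_ge0_pi; rewrite p/=; lra.
Qed.

End profile.

Section exponential_envelope.
Variable R : realType.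
Notation mu := (@lebesgue_measure R).

(** By symmetry the integral is twice that over [0, +oo), where r e^(- r x) is the exponential
    density with total mass 1. *)
Lemma integral_expR_abs (r : R) : 0 < r ->
  (\int[mu]_x (expR (- r * `|x|))%:E = (2 / r)%:E)%E.
Proof.
move=> r0.
have cf : continuous (fun x : R => expR (- r * `|x|)).
  move=> x; apply: (@continuous_comp _ _ _ (fun x : R => - r * `|x|) (@expR R)).
    by apply: cvgM; [exact: cvg_cst|exact: norm_continuous].
  exact: continuous_expR.
rewrite ge0_symfun_integralT//; last by move=> x /=; rewrite normrN.
have H2 : (\int[mu]_(x in `[0%R, +oo[) (r%:E * (expR (- r * `|x|))%:E) = 1)%E.
  rewrite -(integral_exponential_pdf r0) integral_mkcond; apply: eq_integral => x _.
  rewrite patchE; case: ifPn; rewrite ?inE ?notin_setE/= in_itv/= andbT.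
    by move=> x0; rewrite exponential_pdfE// ger0_norm.
  by move=> /negP; rewrite -ltNge => x0; rewrite lt0_exponential_pdf.
have {}H2 : (r%:E * \int[mu]_(x in `[0%R, +oo[) (expR (- r * `|x|))%:E = 1)%E.
  rewrite -H2 ge0_integralZl ?lee_fin ?ltW//.
  by apply/measurable_EFinP; apply: measurable_funTS; exact: continuous_measurable_fun.
rewrite (_ : [set x | 0 <= x] = `[0%R, +oo[%classic); last first.
  by apply/seteqP; split=> x /=; rewrite in_itv/= andbT.
rewrite EFinM; congr (_ * _)%E.
rewrite -[LHS]mul1e -(_ : r^-1%:E * r%:E = 1)%E; last by rewrite -EFinM mulVf// gt_eqF.
by rewrite -muleA H2 mule1.
Qed.

End exponential_envelope.

(** * Dirac operator and potential in real components *)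

Section components.
Variable R : realType.
Implicit Types (v w : C2 R) (z : R[i]) (u : plane R -> C2 R).

Lemma sigma1_mul v : (sigma1 *m v) 0 0 = v 1 0 /\ (sigma1 *m v) 1 0 = v 0 0.
Proof.
by split; rewrite !mxE !big_ord_recl big_ord0 !mxE /= ?mul0r ?mul1r ?addr0 ?add0r;
  congr (v _ _); exact/val_inj.
Qed.

Lemma sigma2_mul v :
  (sigma2 *m v) 0 0 = - 'i%C * v 1 0 /\ (sigma2 *m v) 1 0 = 'i%C * v 0 0.
Proof.
by split; rewrite !mxE !big_ord_recl big_ord0 !mxE /= ?mul0r ?mul1r ?addr0 ?add0r;
  congr (_ * v _ _); exact/val_inj.
Qed.

Lemma sigma3_mul v : (sigma3 *m v) 0 0 = v 0 0 /\ (sigma3 *m v) 1 0 = - v 1 0.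
Proof.
by split; rewrite !mxE !big_ord_recl big_ord0 !mxE /= ?mul0r ?mul1r ?mulN1r ?addr0 ?add0r //;
  congr (- v _ _); exact/val_inj.
Qed.

Lemma Re_mul (x y : R[i]) : complex.Re (x * y) =
  complex.Re x * complex.Re y - complex.Im x * complex.Im y.
Proof. by case: x y => [a b] [c d]. Qed.

Lemma Im_mul (x y : R[i]) : complex.Im (x * y) =
  complex.Re x * complex.Im y + complex.Im x * complex.Re y.
Proof. by case: x y => [a b] [c d]. Qed.

Lemma Re_add (x y : R[i]) : complex.Re (x + y) = complex.Re x + complex.Re y.
Proof. by case: x y => [a b] [c d]. Qed.

Lemma Im_add (x y : R[i]) : complex.Im (x + y) = complex.Im x + complex.Im y.
Proof. by case: x y => [a b] [c d]. Qed.

Lemma Re_opp (x : R[i]) : complex.Re (- x) = - complex.Re x.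
Proof. by case: x. Qed.

Lemma Im_opp (x : R[i]) : complex.Im (- x) = - complex.Im x.
Proof. by case: x. Qed.

Definition reimE := (Re_add, Im_add, Re_opp, Im_opp, Re_mul, Im_mul).

Lemma addC2E v w i : (v + w) i 0 = v i 0 + w i 0.
Proof. by rewrite mxE. Qed.

Lemma oppC2E v i : (- v) i 0 = - v i 0.
Proof. by rewrite mxE. Qed.

Lemma scaleC2E z v i : (z *: v) i 0 = z * v i 0.
Proof. by rewrite mxE. Qed.

Definition C2E := (addC2E, oppC2E, scaleC2E).

Lemma dirac_expr_components m g u x :
  [/\ complex.Re (dirac_expr m g u x 0 0) =
        complex.Im (g 0 x 1 0) - complex.Re (g 1 x 1 0) + m * complex.Re (u x 0 0),
      complex.Im (dirac_expr m g u x 0 0) =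
        - complex.Re (g 0 x 1 0) - complex.Im (g 1 x 1 0) + m * complex.Im (u x 0 0),
      complex.Re (dirac_expr m g u x 1 0) =
        complex.Im (g 0 x 0 0) + complex.Re (g 1 x 0 0) - m * complex.Re (u x 1 0) &
      complex.Im (dirac_expr m g u x 1 0) =
        - complex.Re (g 0 x 0 0) + complex.Im (g 1 x 0 0) - m * complex.Im (u x 1 0)].
Proof.
rewrite /dirac_expr !C2E.
have [-> ->] := sigma1_mul (g 0 x); have [-> ->] := sigma2_mul (g 1 x).
have [-> ->] := sigma3_mul (u x).
by split; rewrite !reimE /=; ring.
Qed.

Lemma interaction_mul eta tau v :
  (interaction eta tau *m v) 0 0 = (eta + tau)%:C * v 0 0 /\
  (interaction eta tau *m v) 1 0 = (eta - tau)%:C * v 1 0.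
Proof.
rewrite /interaction mulmxDl mul_scalar_mx -scalemxAl.
rewrite !C2E.
have [-> ->] := sigma3_mul v.
by rewrite rmorphD rmorphB /= mulrDl mulrBl mulrN.
Qed.

Lemma localized_components eta tau (e : R) x v
    (n := (2 * e)^-1 * \1_([set y : plane R | - e < y.1 < e]) x : R) :
  [/\ complex.Re ((localized (interaction eta tau) e x *m v) 0 0) = n * (eta + tau) * complex.Re (v 0 0),
      complex.Im ((localized (interaction eta tau) e x *m v) 0 0) = n * (eta + tau) * complex.Im (v 0 0),
      complex.Re ((localized (interaction eta tau) e x *m v) 1 0) = n * (eta - tau) * complex.Re (v 1 0) &
      complex.Im ((localized (interaction eta tau) e x *m v) 1 0) = n * (eta - tau) * complex.Im (v 1 0)].
Proof.
rewrite /localized -scalemxAl !C2E -/n.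
have [-> ->] := interaction_mul eta tau v.
by split; rewrite !reimE /=; ring.
Qed.

Definition spinor (a b c d : plane R -> R) (x : plane R) : C2 R :=
  \col_k if k == 0 then a x +i* b x else c x +i* d x.

Lemma spinorE a b c d x : spinor a b c d x 0 0 = a x +i* b x /\ spinor a b c d x 1 0 = c x +i* d x.
Proof. by split; rewrite mxE. Qed.

Lemma reim1_spinor (P : (plane R -> R) -> Prop) a b c d :
  P a -> P b -> P c -> P d -> reim1 P (spinor a b c d).
Proof.
move=> Pa Pb Pc Pd k.
have [->|->] := ord2_cases k; split.
- by rewrite (_ : (fun x => _) = a) //; apply/funext => x; have [-> _] := spinorE a b c d x.
- by rewrite (_ : (fun x => _) = b) //; apply/funext => x; have [-> _] := spinorE a b c d x.
- by rewrite (_ : (fun x => _) = c) //; apply/funext => x; have [_ ->] := spinorE a b c d x.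
- by rewrite (_ : (fun x => _) = d) //; apply/funext => x; have [_ ->] := spinorE a b c d x.
Qed.

Lemma reim2_spinor (P : (plane R -> R) -> (plane R -> R) -> Prop) a b c d a' b' c' d' :
  P a a' -> P b b' -> P c c' -> P d d' -> reim2 P (spinor a b c d) (spinor a' b' c' d').
Proof.
move=> Pa Pb Pc Pd k.
have E r1 r2 r3 r4 : [/\ (fun x => complex.Re (spinor r1 r2 r3 r4 x 0 0)) = r1,
    (fun x => complex.Im (spinor r1 r2 r3 r4 x 0 0)) = r2,
    (fun x => complex.Re (spinor r1 r2 r3 r4 x 1 0)) = r3 &
    (fun x => complex.Im (spinor r1 r2 r3 r4 x 1 0)) = r4].
  by split; apply/funext => x; have [e1 e2] := spinorE r1 r2 r3 r4 x; rewrite ?e1 ?e2.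
have [E1 E2 E3 E4] := E a b c d; have [E1' E2' E3' E4'] := E a' b' c' d'.
by have [->|->] := ord2_cases k; rewrite ?E1 ?E2 ?E3 ?E4 ?E1' ?E2' ?E3' ?E4'.
Qed.


End components.

(** * Restriction to the half-plane and exponential envelopes *)

Section domains.
Variable R : realType.

(** A test function of D and its partial derivatives vanish off D, so the integrals over D and over
    the plane agree. *)
Lemma weak_partialS (D : set (plane R)) j (u g : plane R -> R) :
  weak_partial setT j u g -> weak_partial D j u g.
Proof.
move=> wu phi tf; have := wu phi (test_functionW (@subsetT _ _) tf).
have out (f : plane R -> R) (h : plane R -> R) : (forall x, ~ D x -> h x = 0) ->
    \int[leb2]_(x in D) (f x * h x) = \int[leb2]_x (f x * h x).
  move=> h0; rewrite Rintegral_mkcond; congr Rintegral; apply/funext => x.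
  by rewrite patchE; case: ifPn => //; rewrite notin_setE => /h0 ->; rewrite mulr0.
rewrite -!out//; first by move=> x /(test_function_out tf)[].
by move=> x /(test_function_out tf)[_ ->].
Qed.

Lemma measurable_Omega_minus : measurable (@Omega_minus R : set (plane R)).
Proof.
rewrite (_ : @Omega_minus R = fst @^-1` `]0, +oo[%classic).
  by rewrite -[X in measurable X]setTI; apply: measurable_fst => //; exact: measurable_itv.
by apply/seteqP; split=> x /=; rewrite in_itv/= andbT.
Qed.

(** One weight records the decay in x1 and the cut-off in x2. Its L^2 norm is the square root of 2 /
    r, so for r = k / e it has the order e^(1 / 2), which dictates the normalisation of the
    quasimode. *)
Definition envelope (r : R) (x : plane R) : R :=
  expR (- r * `|x.1|) * \1_(`[(-1)%R, 1%R]%classic : set R) x.2.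

Lemma measurable_envelope r : measurable_fun setT (envelope r).
Proof.
apply: (@measurable_tensor R (fun s => expR (- r * `|s|)) (\1_(`[(-1)%R, 1%R]%classic))).
  by apply: (measurableT_comp (f := @expR R)) => //; apply: measurable_funM.
exact: measurable_indic.
Qed.

Lemma envelope_ge0 r x : 0 <= envelope r x.
Proof. by rewrite mulr_ge0 ?expR_ge0. Qed.

Lemma integral_envelope (r : R) : 0 < r ->
  (\int[leb2]_x (envelope r x ^+ 2)%:E = (2 / r)%:E)%E.
Proof.
move=> r0; rewrite /leb2 fubini_tonelli1//=; last 2 first.
- by apply/measurable_EFinP; apply: measurable_funX; exact: measurable_envelope.
- by move=> x; rewrite lee_fin sqr_ge0.
have r20 : 0 < 2 * r by rewrite mulr_gt0.
transitivity (\int[lebesgue_measure]_x (2%:E * (expR (- (2 * r) * `|x|))%:E))%E.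
  apply: eq_integral => x _; rewrite /fubini_F.
  under eq_integral do rewrite /envelope/= exprMn EFinM.
  rewrite ge0_integralZl ?lee_fin ?sqr_ge0//; last first.
    by apply/measurable_EFinP; apply: measurable_funX; exact: measurable_indic.
  rewrite muleC; congr (_ * _)%E; last first.
    by congr EFin; rewrite expr2 -expRD; congr expR; ring.
  transitivity (\int[lebesgue_measure]_y (\1_(`[(-1)%R, 1%R]%classic : set R) y)%:E)%E.
    by apply: eq_integral => y _; rewrite indicE; case: (y \in _); rewrite ?expr1n ?expr0n.
  have L : lebesgue_measure (`[(-1)%R, 1%R]%classic : set R) = 2%:E.
    rewrite lebesgue_measure_itv/= lte_fin ifT; last by lra.
    by rewrite -EFinD; congr EFin; lra.
  by rewrite integral_indic// setIT; exact: L.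
rewrite ge0_integralZl//.
- by rewrite integral_expR_abs// -EFinM; congr EFin; field; rewrite gt_eqF.
- apply/measurable_EFinP; apply: (measurableT_comp (f := @expR R)) => //.
  by apply: measurable_funM => //; exact: measurableT_comp.
Qed.

Lemma L2_envelope (u : plane R -> C2 R) (r K : R) : 0 < r -> 0 <= K ->
    reim1 (fun f => measurable_fun setT f) u ->
    (forall x, euclid (u x) <= K * envelope r x) ->
  L2 leb2 setT u /\ (L2norm leb2 setT u <= (K * Num.sqrt (2 / r))%:E)%E.
Proof.
move=> r0 K0 mu uK.
have r20 : 0 <= 2 / r by rewrite divr_ge0// ltW.
have le : (L2norm leb2 setT u <= (K * Num.sqrt (2 / r))%:E)%E.
  apply: L2norm_le uK mu (measurable_envelope r) _ => //.
  by rewrite sqr_sqrtr// integral_envelope.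
by split=> //; split=> //; apply: le_lt_trans le _; rewrite ltry.
Qed.

End domains.

Section enveloped.
Variable R : realType.
Implicit Types (f h : plane R -> R) (r K : R).

(** The property is stable under linear combinations and gives both membership in L^2 and an
    explicit bound of the norm. *)
Definition enveloped r K f := measurable_fun setT f /\
  forall x, `|f x| <= K * envelope r x.

Lemma enveloped_le r K L f : K <= L -> enveloped r K f -> enveloped r L f.
Proof.
move=> KL [mf fK]; split=> // x; apply: le_trans (fK x) _.
by rewrite ler_wpM2r ?envelope_ge0.
Qed.

Lemma envelopedD r K L f h : enveloped r K f -> enveloped r L h ->
  enveloped r (K + L) (fun x => f x + h x).
Proof.
move=> [mf fK] [mh hL]; split=> [|x]; first exact: measurable_funD.
by rewrite mulrDl (le_trans (ler_normD _ _))// lerD.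
Qed.

Lemma envelopedZ r K (s : R) f : enveloped r K f ->
  enveloped r (`|s| * K) (fun x => s * f x).
Proof.
move=> [mf fK]; split=> [|x]; first exact: measurable_funM.
by rewrite normrM -mulrA ler_wpM2l.
Qed.

Lemma envelopedB r K L f h : enveloped r K f -> enveloped r L h ->
  enveloped r (K + L) (fun x => f x - h x).
Proof.
move=> ef /(envelopedZ (-1)); rewrite normrN normr1 mul1r => eh.
have := envelopedD ef eh.
by under eq_fun do rewrite mulN1r.
Qed.

Lemma enveloped_tensor r K L (X E : R -> R) :
    measurable_fun setT X -> measurable_fun setT E ->
    (forall s, `|X s| <= K * expR (- r * `|s|)) ->
    (forall s, `|E s| <= L * \1_(`[(-1)%R, 1%R]%classic : set R) s) ->
  enveloped r (K * L) (tensor X E).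
Proof.
move=> mX mE XK EL; split=> [|x]; first exact: measurable_tensor.
by rewrite /tensor /envelope normrM mulrACA ler_pM.
Qed.

Lemma enveloped_L2 (u : plane R -> C2 R) r K : 0 < r -> 0 <= K ->
    reim1 (enveloped r K) u ->
  L2 leb2 setT u /\ (L2norm leb2 setT u <= (2 * K * Num.sqrt (2 / r))%:E)%E.
Proof.
move=> r0 K0 eu; apply: L2_envelope => //; first by rewrite mulr_ge0.
  by move=> j; have [[? _] [? _]] := eu j.
move=> x; rewrite -mulrA; apply: euclid_le; first by rewrite mulr_ge0 ?envelope_ge0.
by move=> j; have [[_ ?] [_ ?]] := eu j.
Qed.

Lemma enveloped_resid (z : R[i]) (F u : plane R -> C2 R) r K L :
    reim1 (enveloped r K) F -> reim1 (enveloped r L) u ->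
  reim1 (enveloped r (K + (`|complex.Re z| + `|complex.Im z|) * L))
    (fun x => F x - z *: u x).
Proof.
move=> eF eu j; have [F1 F2] := eF j; have [u1 u2] := eu j; split.
- rewrite (_ : (fun x => _) = (fun x => complex.Re (F x j 0) -
    (complex.Re z * complex.Re (u x j 0) - complex.Im z * complex.Im (u x j 0)))).
    by rewrite mulrDl; apply: envelopedB => //; apply: envelopedB; exact: envelopedZ.
  by apply/funext => x; rewrite !C2E !reimE.
- rewrite (_ : (fun x => _) = (fun x => complex.Im (F x j 0) -
    (complex.Re z * complex.Im (u x j 0) + complex.Im z * complex.Re (u x j 0)))).
    by rewrite mulrDl; apply: envelopedB => //; apply: envelopedD; exact: envelopedZ.
  by apply/funext => x; rewrite !C2E !reimE.
Qed.

Lemma C2_eq (v v' : C2 R) : (forall j, complex.Re (v j 0) = complex.Re (v' j 0) /\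
  complex.Im (v j 0) = complex.Im (v' j 0)) -> v = v'.
Proof.
move=> E; apply/matrixP => j l; rewrite ord1; apply/eqP; rewrite eq_complex.
by have [-> ->] := E j; rewrite !eqxx.
Qed.

End enveloped.

Section bump_derivative.
Variable R : realType.

Lemma bump_indic (s : R) : bumpR s <= \1_(`[(-1)%R, 1%R]%classic : set R) s.
Proof.
rewrite indicE; have [|] := boolP (4^-1 < s < 3 / 4).
  by move=> /andP[s1 s2]; rewrite mem_set ?bump_le1//= in_itv/=; apply/andP; split; lra.
by move=> /bump_out ->.
Qed.

Lemma derive_bump_bound : exists2 B : R, 0 <= B & forall s,
  `|((@bumpR R)^`())%classic s| <= B * \1_(`[(-1)%R, 1%R]%classic : set R) s.
Proof.
have [B BP] := Cn1_bounded (-1) 1 (smooth_bump R 1).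
have B0 : 0 <= B by have [+ _] := BP 0 (ltac:(apply/andP; split; lra)); exact: le_trans.
exists B => // s; rewrite indicE.
have [s1|s1] := leP `|s| 1.
  by rewrite mem_set ?mulr1/= ?in_itv/= -?ler_norml//; apply: (BP _ _).2; rewrite -ler_norml.
rewrite (derive1_out (M := 3 / 4)) ?normr0 ?mulr_ge0//; last by lra.
move=> y y1; apply: bump_out; apply/negP => /andP[y2 y3].
by move: y1; rewrite ger0_norm; lra.
Qed.

End bump_derivative.

(** * Quasimodes *)

Section quasimode.
Variables (R : realType) (m eta tau g w k e N B1 : R).
Implicit Types (C S s : R).
Hypothesis w_itv : pi / 4 < w < pi / 2.
Hypothesis gw : g * sin (2 * w) = w.
Hypothesis kE : k = - g * cos (2 * w).
Hypothesis abE : (eta + tau) / 2 * ((eta - tau) / 2) = g ^+ 2.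
Hypothesis e_gt0 : 0 < e.
Hypothesis N_ge0 : 0 <= N.
Hypothesis B1_ge0 : 0 <= B1.
Hypothesis B1_bound : forall s,
  `|((@bumpR R)^`())%classic s| <= B1 * \1_(`[(-1)%R, 1%R]%classic : set R) s.

Notation lam := (k / e).
Notation unit_itv := (`[(-1)%R, 1%R]%classic : set R).

(** Real coordinates of an oscillation of frequency k / e: differentiation sends (C, S) to (S, - C),
    times the frequency. *)
Definition carrier C S s := C * cos (lam * s) + S * sin (lam * s).
Definition osc C S s := bumpR s * carrier C S s.
(* The part of the derivative of [osc] in which the cut-off is differentiated; only
   this part survives in [quasimode_image]. *)
Definition bosc C S s := ((@bumpR R)^`())%classic s * carrier C S s.
Definition dosc C S s := bosc C S s + lam * osc S (- C) s.

Lemma smooth_carrier C S : smooth (carrier C S).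
Proof.
move=> n; have [cc cs] := Cn_cos_sin R n.
have h (f : R -> R) r : Cn n f -> Cn n (fun s => r * f (lam * s)).
  move=> /(Cn_affine lam 0) Cf; apply: Cn_const_mul.
  by under eq_fun do rewrite -[lam * _]addr0.
by apply: CnD; exact: h.
Qed.

Lemma carrier_le C S s : `|carrier C S s| <= `|C| + `|S|.
Proof.
rewrite (le_trans (ler_normD _ _))// !normrM.
by rewrite lerD// ler_piMr// ?sin_max ?cos_max.
Qed.

Lemma smooth_osc C S : smooth (osc C S).
Proof. by move=> n; apply: CnM; [exact: smooth_bump|exact: smooth_carrier]. Qed.

Lemma is_derive_carrier C S s : is_derive s 1 (carrier C S) (lam * carrier S (- C) s).
Proof.
have dc : is_derive s 1 (fun s => cos (lam * s)) (lam * - sin (lam * s)).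
  have := is_derive_affine (b := 0) (is_derive_cos (lam * s + 0)).
  by under eq_fun do rewrite addr0; rewrite addr0.
have ds : is_derive s 1 (fun s => sin (lam * s)) (lam * cos (lam * s)).
  have := is_derive_affine (b := 0) (is_derive_sin (lam * s + 0)).
  by under eq_fun do rewrite addr0; rewrite addr0.
apply: (is_derive_eq (is_deriveD (is_deriveZ C dc) (is_deriveZ S ds))).
by rewrite /carrier /GRing.scale/=; ring.
Qed.

Lemma derive_osc C S : ((osc C S)^`())%classic = dosc C S.
Proof.
apply/funext => s.
have dc := is_derive_carrier C S s.
have db : is_derive s 1 (@bumpR R) (((@bumpR R)^`())%classic s).
  by rewrite derive1E; apply: DeriveDef => //; exact: (CnS_derivable (smooth_bump R 1)).
have := @derive_val _ _ _ _ _ _ _ (is_deriveM db dc).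
move=> H; rewrite derive1E; apply: etrans H _; rewrite /dosc /bosc /osc /GRing.scale/=; ring.
Qed.

Lemma osc_le C S s : `|osc C S s| <= (`|C| + `|S|) * \1_unit_itv s.
Proof.
rewrite normrM mulrC ler_pM ?carrier_le// (ger0_norm (bump_ge0 s)).
exact: bump_indic.
Qed.

Lemma bosc_le C S s : `|bosc C S s| <= (B1 * (`|C| + `|S|)) * \1_unit_itv s.
Proof. by rewrite normrM mulrAC ler_pM ?carrier_le. Qed.

Lemma lam_gt0 : 0 < lam.
Proof. by rewrite divr_gt0// (k_gt0 w_itv gw kE). Qed.

Lemma dosc_le C S s : `|dosc C S s| <= ((B1 + lam) * (`|C| + `|S|)) * \1_unit_itv s.
Proof.
rewrite (le_trans (ler_normD _ _))// !mulrDl lerD ?bosc_le//.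
rewrite normrM (ger0_norm (ltW lam_gt0)) -mulrA ler_wpM2l ?(ltW lam_gt0)//.
by have := osc_le S (- C) s; rewrite normrN addrC.
Qed.

Lemma measurable_osc C S : measurable_fun setT (osc C S).
Proof. exact: continuous_measurable_fun (Cn_continuous (smooth_osc C S 0)). Qed.

Lemma measurable_bosc C S : measurable_fun setT (bosc C S).
Proof.
apply: measurable_funM; apply: continuous_measurable_fun.
  exact: Cn_continuous (CnS_derive (smooth_bump R 1)).
exact: Cn_continuous (smooth_carrier C S 0).
Qed.

Lemma measurable_dosc C S : measurable_fun setT (dosc C S).
Proof.
apply: measurable_funD; first exact: measurable_bosc.
by apply: measurable_funM => //; exact: measurable_osc.
Qed.

Lemma indic_le1 s : \1_unit_itv s <= 1 :> R.
Proof. by rewrite indicE; case: (_ \in _). Qed.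

Lemma bounded_osc C S : bounded_measurable (osc C S).
Proof.
split; first exact: measurable_osc.
exists (`|C| + `|S|) => s; apply: le_trans (osc_le C S s) _.
by rewrite ler_piMr ?indic_le1// addr_ge0.
Qed.

Lemma bounded_dosc C S : bounded_measurable (dosc C S).
Proof.
split; first exact: measurable_dosc.
exists ((B1 + lam) * (`|C| + `|S|)) => s; apply: le_trans (dosc_le C S s) _.
by rewrite ler_piMr ?indic_le1// mulr_ge0 ?addr_ge0// ltW// lam_gt0.
Qed.

Lemma weak_osc C S : weak (osc C S) (dosc C S).
Proof.
apply: (weak_on_weak (M0 := 0) (bounded_osc C S) (bounded_dosc C S)) => M M0.
apply: (weak_on_Cn1 _ (smooth_osc C S 1) (bounded_osc C S) (bounded_dosc C S)) => //.
  by lra.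
by move=> x _; rewrite derive_osc.
Qed.

Definition amp0 s := profile w k (- e^-1 * s).
Definition amp1 s := profile w k (e^-1 * s).
Definition damp0 s := - e^-1 * dprofile g w k (- e^-1 * s).
Definition damp1 s := e^-1 * dprofile g w k (e^-1 * s).
Notation A := (N * g).
Notation B := (N * ((eta + tau) / 2)).

(** The bound mode cut off in x2 and multiplied by N, in real form. In the second component the
    factor - i replaces the pair (cos, sin) of real and imaginary parts by (sin, - cos). *)
Definition quasimode : plane R -> C2 R :=
  spinor (tensor amp0 (osc A 0)) (tensor amp0 (osc 0 A))
     (tensor amp1 (osc 0 B)) (tensor amp1 (osc (- B) 0)).

Definition quasimode_grad (j : 'I_2) : plane R -> C2 R := if j == 0 then
    spinor (tensor damp0 (osc A 0)) (tensor damp0 (osc 0 A))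
       (tensor damp1 (osc 0 B)) (tensor damp1 (osc (- B) 0))
  else
    spinor (tensor amp0 (dosc A 0)) (tensor amp0 (dosc 0 A))
       (tensor amp1 (dosc 0 B)) (tensor amp1 (dosc (- B) 0)).

Definition quasimode_image (x : plane R) : C2 R :=
  dirac_expr m quasimode_grad quasimode x +
  localized (interaction eta tau) e x *m quasimode x.

(** All terms of order 1 / e cancel: those from the profile, from the oscillation and from the
    potential. The derivative of the cut-off and the mass term remain, so the image is bounded by a
    multiple of N that does not depend on e. *)
Lemma quasimode_imageE : quasimode_image =
  spinor (fun x => tensor amp1 (bosc 0 (- B)) x + m * tensor amp0 (osc A 0) x)
     (fun x => tensor amp1 (bosc B 0) x + m * tensor amp0 (osc 0 A) x)
     (fun x => tensor amp0 (bosc A 0) x - m * tensor amp1 (osc 0 B) x)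
     (fun x => tensor amp0 (bosc 0 A) x - m * tensor amp1 (osc (- B) 0) x).
Proof.
(* The ratio of the two amplitudes is fixed by the first component; [abE] is what makes the second
   component balance with the same coupling g. *)
have gE : (eta - tau) / 2 * B = A * g by rewrite mulrCA mulrC [X in X * _]mulrC abE; ring.
have e0 : e != 0 by rewrite gt_eqF.
apply/funext => x; apply: C2_eq => j.
rewrite /quasimode_image (addC2E (dirac_expr _ _ _ _)) Re_add Im_add.
have [d1 d2 d3 d4] := dirac_expr_components m quasimode_grad quasimode x.
have [l1 l2 l3 l4] := localized_components eta tau e x (quasimode x).
(* The strip is symmetric, so the indicators in [damp0], in [damp1] and in the potential are one and
   the same number, and the identities become algebraic in it. *)
pose chi := (-1 < e^-1 * x.1 < 1).
have chi1 : \1_([set y : plane R | - e < y.1 < e]) x = chi%:R :> R.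
  rewrite indicE; congr (nat_of_bool _)%:R; apply/idP/idP.
    by rewrite inE/= /chi mulrC ltr_pdivlMr// ltr_pdivrMr// mulN1r mul1r.
  by rewrite inE/= /chi mulrC ltr_pdivlMr// ltr_pdivrMr// mulN1r mul1r.
have chi2 : (-1 < - e^-1 * x.1 < 1) = chi.
  by rewrite /chi mulNr ltrNl opprK ltrNl andbC.
have dPE : damp0 x.1 = e^-1 * (k * amp0 x.1 - chi%:R * (g * amp1 x.1)).
  rewrite /damp0 /dprofile chi2 -/(amp0 x.1) -mulNr opprK -/(amp1 x.1).
  by case: ifP => _ /=; ring.
have dQE : damp1 x.1 = e^-1 * (- k * amp1 x.1 + chi%:R * (g * amp0 x.1)).
  rewrite /damp1 /dprofile -/(amp1 x.1) -/chi -mulNr -/(amp0 x.1).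
  by case: ifP => _ /=; ring.
have [U0 U1] := spinorE (tensor amp0 (osc A 0)) (tensor amp0 (osc 0 A))
  (tensor amp1 (osc 0 B)) (tensor amp1 (osc (- B) 0)) x.
have [V0 V1] := spinorE (tensor damp0 (osc A 0)) (tensor damp0 (osc 0 A))
  (tensor damp1 (osc 0 B)) (tensor damp1 (osc (- B) 0)) x.
have [W0 W1] := spinorE (tensor amp0 (dosc A 0)) (tensor amp0 (dosc 0 A))
  (tensor amp1 (dosc 0 B)) (tensor amp1 (dosc (- B) 0)) x.
rewrite -/quasimode in U0 U1.
rewrite -/(quasimode_grad 0) in V0 V1; rewrite -/(quasimode_grad 1) in W0 W1.
rewrite U0 V1 W1 /= in d1 d2; rewrite U1 V0 W0 /= in d3 d4.
rewrite chi1 U0 /= in l1 l2; rewrite chi1 U1 /= in l3 l4.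
clear chi1 chi2; move: (chi%:R : R) dPE dQE d1 d2 d3 d4 l1 l2 l3 l4 => n dPE dQE d1 d2 d3 d4 l1 l2 l3 l4.
rewrite /tensor dPE dQE /dosc /osc in d1 d2 d3 d4 l1 l2 l3 l4.
have E1 a b c d := (spinorE a b c d x).1; have E2 a b c d := (spinorE a b c d x).2.
have [->|->] := ord2_cases j; rewrite !(E1, E2)/=; split.
- by rewrite d1 l1 /tensor /bosc /osc /carrier; field.
- by rewrite d2 l2 /tensor /bosc /osc /carrier; field.
- rewrite d3 l3 /tensor (_ : _ * (eta - tau) * _ = e^-1 * n * (A * g) * (amp1 x.1 * (bumpR x.2 * sin (lam * x.2)))).
    by rewrite /bosc /osc /carrier; ring.
  by rewrite -gE /osc /carrier; field.
- rewrite d4 l4 /tensor (_ : _ * (eta - tau) * _ = - (e^-1 * n * (A * g) * (amp1 x.1 * (bumpR x.2 * cos (lam * x.2))))).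
    by rewrite /bosc /osc /carrier; ring.
  by rewrite -gE /osc /carrier; field.
Qed.

Notation S0 := (expR k * (g + `|(eta + tau) / 2|)).

Lemma S0_ge0 : 0 <= S0.
Proof. by rewrite mulr_ge0 ?expR_ge0// addr_ge0// ltW// (g_gt0 w_itv gw). Qed.

Lemma dprofile_bound y :
  `|dprofile g w k y| <= (k + g) * expR k * expR (- k * `|y|).
Proof.
have k0 := ltW (k_gt0 w_itv gw kE); have g0 := ltW (g_gt0 w_itv gw).
have bnd := profile_bound w_itv gw kE.
rewrite /dprofile (le_trans (ler_normD _ _))// -mulrA mulrDl lerD//.
  by rewrite normrM normrN (ger0_norm k0) ler_wpM2l.
case: ifP => _; last by rewrite normr0 mulr_ge0// mulr_ge0 ?expR_ge0.
by rewrite normrM (ger0_norm g0) ler_wpM2l// (le_trans (bnd _))// normrN.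
Qed.

Lemma rate_scale (c s : R) : `|c| = e^-1 -> - k * `|c * s| = - lam * `|s|.
Proof. by move=> cE; rewrite normrM cE; ring. Qed.

Lemma norm_invN : `|- e^-1| = e^-1.
Proof. by rewrite normrN gtr0_norm// invr_gt0. Qed.

Lemma norm_inv : `|e^-1| = e^-1.
Proof. by rewrite gtr0_norm// invr_gt0. Qed.

Lemma amp0_le s : `|amp0 s| <= expR k * expR (- lam * `|s|).
Proof. by rewrite -(rate_scale s norm_invN); exact: profile_bound w_itv gw kE _. Qed.

Lemma amp1_le s : `|amp1 s| <= expR k * expR (- lam * `|s|).
Proof. by rewrite -(rate_scale s norm_inv); exact: profile_bound w_itv gw kE _. Qed.

Lemma damp0_le s : `|damp0 s| <= (e^-1 * ((k + g) * expR k)) * expR (- lam * `|s|).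
Proof.
rewrite -(rate_scale s norm_invN) normrM norm_invN -mulrA ler_wpM2l ?invr_ge0 ?(ltW e_gt0)//.
exact: dprofile_bound.
Qed.

Lemma damp1_le s : `|damp1 s| <= (e^-1 * ((k + g) * expR k)) * expR (- lam * `|s|).
Proof.
rewrite -(rate_scale s norm_inv) normrM norm_inv -mulrA ler_wpM2l ?invr_ge0 ?(ltW e_gt0)//.
exact: dprofile_bound.
Qed.

Let bmP := bounded_measurable_profile w_itv gw kE.
Let bmdP := bounded_measurable_dprofile w_itv gw kE.

Lemma enveloped_amp0 (E : R -> R) L : measurable_fun setT E ->
    (forall s, `|E s| <= L * \1_unit_itv s) ->
  enveloped lam (expR k * L) (tensor amp0 E).
Proof. by move=> mE EL; apply: enveloped_tensor => //; [exact: (bmP _).1|exact: amp0_le]. Qed.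

Lemma enveloped_amp1 (E : R -> R) L : measurable_fun setT E ->
    (forall s, `|E s| <= L * \1_unit_itv s) ->
  enveloped lam (expR k * L) (tensor amp1 E).
Proof. by move=> mE EL; apply: enveloped_tensor => //; [exact: (bmP _).1|exact: amp1_le]. Qed.

Lemma enveloped_damp0 (E : R -> R) L : measurable_fun setT E ->
    (forall s, `|E s| <= L * \1_unit_itv s) ->
  enveloped lam (e^-1 * ((k + g) * expR k) * L) (tensor damp0 E).
Proof. by move=> mE EL; apply: enveloped_tensor => //; [exact: (bmdP _).1|exact: damp0_le]. Qed.

Lemma enveloped_damp1 (E : R -> R) L : measurable_fun setT E ->
    (forall s, `|E s| <= L * \1_unit_itv s) ->
  enveloped lam (e^-1 * ((k + g) * expR k) * L) (tensor damp1 E).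
Proof. by move=> mE EL; apply: enveloped_tensor => //; [exact: (bmdP _).1|exact: damp1_le]. Qed.

Notation coef := (g + `|(eta + tau) / 2|).

Lemma normA : `|A| + `|0 : R| <= N * coef.
Proof.
rewrite normr0 addr0 normrM (ger0_norm N_ge0) ler_wpM2l//.
by rewrite ger0_norm ?lerDl// ltW// (g_gt0 w_itv gw).
Qed.

Lemma normA' : `|0 : R| + `|A| <= N * coef.
Proof. by rewrite addrC normA. Qed.

Lemma normB' : `|0 : R| + `|B| <= N * coef.
Proof.
rewrite normr0 add0r normrM (ger0_norm N_ge0) ler_wpM2l//.
by rewrite lerDr ltW// (g_gt0 w_itv gw).
Qed.

Lemma normB : `|B| + `|0 : R| <= N * coef.
Proof. by rewrite addrC normB'. Qed.

Lemma normBN : `|- B| + `|0 : R| <= N * coef.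
Proof. by rewrite normrN normB. Qed.

Lemma normBN' : `|0 : R| + `|- B| <= N * coef.
Proof. by rewrite normrN normB'. Qed.

Lemma quasimode_enveloped : reim1 (enveloped lam (N * S0)) quasimode.
Proof.
have h C S : `|C| + `|S| <= N * coef -> expR k * (`|C| + `|S|) <= N * S0.
  by move=> CS; rewrite [leRHS]mulrCA ler_wpM2l ?expR_ge0.
apply: reim1_spinor; apply: enveloped_le (h _ _ _) _.
- exact: normA.
- apply: enveloped_amp0; [exact: measurable_osc|exact: osc_le].
- exact: normA'.
- apply: enveloped_amp0; [exact: measurable_osc|exact: osc_le].
- exact: normB'.
- apply: enveloped_amp1; [exact: measurable_osc|exact: osc_le].
- exact: normBN.
- apply: enveloped_amp1; [exact: measurable_osc|exact: osc_le].
Qed.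

Lemma quasimode_image_enveloped :
  reim1 (enveloped lam (N * S0 * B1 + `|m| * (N * S0))) quasimode_image.
Proof.
have h C S : `|C| + `|S| <= N * coef -> expR k * (`|C| + `|S|) <= N * S0.
  by move=> CS; rewrite [leRHS]mulrCA ler_wpM2l ?expR_ge0.
have hb C S : `|C| + `|S| <= N * coef -> expR k * (B1 * (`|C| + `|S|)) <= N * S0 * B1.
  by move=> CS; rewrite mulrCA mulrC ler_wpM2r// h.
have eP C S : `|C| + `|S| <= N * coef -> enveloped lam (N * S0) (tensor amp0 (osc C S)).
  move=> CS; apply: enveloped_le (h _ _ CS) _.
  by apply: enveloped_amp0; [exact: measurable_osc|exact: osc_le].
have eQ C S : `|C| + `|S| <= N * coef -> enveloped lam (N * S0) (tensor amp1 (osc C S)).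
  move=> CS; apply: enveloped_le (h _ _ CS) _.
  by apply: enveloped_amp1; [exact: measurable_osc|exact: osc_le].
have bP C S : `|C| + `|S| <= N * coef -> enveloped lam (N * S0 * B1) (tensor amp0 (bosc C S)).
  move=> CS; apply: enveloped_le (hb _ _ CS) _.
  by apply: enveloped_amp0; [exact: measurable_bosc|exact: bosc_le].
have bQ C S : `|C| + `|S| <= N * coef -> enveloped lam (N * S0 * B1) (tensor amp1 (bosc C S)).
  move=> CS; apply: enveloped_le (hb _ _ CS) _.
  by apply: enveloped_amp1; [exact: measurable_bosc|exact: bosc_le].
rewrite quasimode_imageE; apply: reim1_spinor.
- by apply: envelopedD; [exact: bQ normBN'|exact/envelopedZ/eP/normA].
- by apply: envelopedD; [exact: bQ normB|exact/envelopedZ/eP/normA'].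
- by apply: envelopedB; [exact: bP normA|exact/envelopedZ/eQ/normB'].
- by apply: envelopedB; [exact: bP normA'|exact/envelopedZ/eQ/normBN].
Qed.

Lemma quasimode_grad_enveloped j : exists2 K, 0 <= K &
  reim1 (enveloped lam K) (quasimode_grad j).
Proof.
have k0 := ltW (k_gt0 w_itv gw kE); have g0 := ltW (g_gt0 w_itv gw).
have l0 := ltW lam_gt0.
have c0 : 0 <= coef by rewrite addr_ge0.
have e0 : 0 <= e^-1 by rewrite invr_ge0 ltW.
have [->|->] := ord2_cases j; rewrite /quasimode_grad /=.
- exists (e^-1 * ((k + g) * expR k) * (N * coef)); first by rewrite !mulr_ge0 ?addr_ge0 ?expR_ge0.
  have h C S : `|C| + `|S| <= N * coef ->
      e^-1 * ((k + g) * expR k) * (`|C| + `|S|) <= e^-1 * ((k + g) * expR k) * (N * coef).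
    by move=> CS; rewrite ler_wpM2l// !mulr_ge0 ?addr_ge0 ?expR_ge0.
  apply: reim1_spinor; apply: enveloped_le (h _ _ _) _.
  + exact: normA.
  + apply: enveloped_damp0; [exact: measurable_osc|exact: osc_le].
  + exact: normA'.
  + apply: enveloped_damp0; [exact: measurable_osc|exact: osc_le].
  + exact: normB'.
  + apply: enveloped_damp1; [exact: measurable_osc|exact: osc_le].
  + exact: normBN.
  + apply: enveloped_damp1; [exact: measurable_osc|exact: osc_le].
- exists (expR k * ((B1 + lam) * (N * coef))); first by rewrite !mulr_ge0 ?addr_ge0 ?expR_ge0.
  have h C S : `|C| + `|S| <= N * coef ->
      expR k * ((B1 + lam) * (`|C| + `|S|)) <= expR k * ((B1 + lam) * (N * coef)).
    by move=> CS; rewrite !ler_wpM2l ?expR_ge0 ?addr_ge0.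
  apply: reim1_spinor; apply: enveloped_le (h _ _ _) _.
  + exact: normA.
  + apply: enveloped_amp0; [exact: measurable_dosc|exact: dosc_le].
  + exact: normA'.
  + apply: enveloped_amp0; [exact: measurable_dosc|exact: dosc_le].
  + exact: normB'.
  + apply: enveloped_amp1; [exact: measurable_dosc|exact: dosc_le].
  + exact: normBN.
  + apply: enveloped_amp1; [exact: measurable_dosc|exact: dosc_le].
Qed.

Lemma quasimode_weak j : reim2 (weak_partial setT j) quasimode (quasimode_grad j).
Proof.
have e0 : e^-1 != 0 by rewrite invr_neq0// gt_eqF.
have wP : weak amp0 damp0 by apply: (weak_profile w_itv gw kE); rewrite oppr_eq0.
have wQ : weak amp1 damp1 by exact: (weak_profile w_itv gw kE).
have [->|->] := ord2_cases j; rewrite /quasimode_grad /=; apply: reim2_spinor.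
- exact: weak_partial_tensor0 (bmP _) (bmdP _) (bounded_osc _ _) wP.
- exact: weak_partial_tensor0 (bmP _) (bmdP _) (bounded_osc _ _) wP.
- exact: weak_partial_tensor0 (bmP _) (bmdP _) (bounded_osc _ _) wQ.
- exact: weak_partial_tensor0 (bmP _) (bmdP _) (bounded_osc _ _) wQ.
- exact: weak_partial_tensor1 (bounded_osc _ _) (bounded_dosc _ _) (bmP _) (weak_osc _ _).
- exact: weak_partial_tensor1 (bounded_osc _ _) (bounded_dosc _ _) (bmP _) (weak_osc _ _).
- exact: weak_partial_tensor1 (bounded_osc _ _) (bounded_dosc _ _) (bmP _) (weak_osc _ _).
- exact: weak_partial_tensor1 (bounded_osc _ _) (bounded_dosc _ _) (bmP _) (weak_osc _ _).
Qed.

Lemma quasimode_H1 : H1_grad setT quasimode quasimode_grad.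
Proof.
split=> [|j].
  by have [] := enveloped_L2 lam_gt0 (mulr_ge0 N_ge0 S0_ge0) quasimode_enveloped.
split; last exact: quasimode_weak.
by have [K K0 eK] := quasimode_grad_enveloped j; have [] := enveloped_L2 lam_gt0 K0 eK.
Qed.

Lemma quasimode_dom : dirac_potential m (localized (interaction eta tau) e)
  quasimode quasimode_image.
Proof.
split.
  have K0 : 0 <= N * S0 * B1 + `|m| * (N * S0).
    have NS0 := mulr_ge0 N_ge0 S0_ge0.
    by apply: addr_ge0; apply: mulr_ge0.
  by have [] := enveloped_L2 lam_gt0 K0 quasimode_image_enveloped.
exists quasimode_grad; split; first exact: quasimode_H1.
by apply: aeW => x.
Qed.

(** The constant K is free of e. In the bound, e enters only through N and through the square root,
    of order e^(1 / 2). *)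
Lemma quasimode_resid_L2 (z : R[i]) (K := S0 * (B1 + `|m| + `|complex.Re z| + `|complex.Im z|)) :
  L2 leb2 setT (fun x => quasimode_image x - z *: quasimode x) /\
  (L2norm leb2 setT (fun x => (quasimode_image x - z *: quasimode x)%R) <=
    (2 * (N * K) * Num.sqrt (2 / lam))%:E)%E.
Proof.
have NS0 := mulr_ge0 N_ge0 S0_ge0.
have eK := enveloped_resid z quasimode_image_enveloped quasimode_enveloped.
have KE : N * S0 * B1 + `|m| * (N * S0) +
    (`|complex.Re z| + `|complex.Im z|) * (N * S0) = N * K by rewrite /K; ring.
rewrite KE in eK.
apply: (enveloped_L2 lam_gt0 _ eK).
by rewrite mulr_ge0// mulr_ge0 ?S0_ge0// !addr_ge0.
Qed.

End quasimode.

(** * Testing in the half-plane *)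

Section tested.
Variables (R : realType) (D : set (plane R)) (v : plane R -> R).
Hypothesis mD : measurable D.
Hypothesis mv : measurable_fun D v.
Implicit Types (f h : plane R -> R) (c s : R).

(** Integrability accompanies the bound because splitting the integral of a sum requires it of each
    summand. *)
Definition tested c f := measurable_fun D f /\
  leb2.-integrable D (EFin \o (fun x => f x * v x)) /\
  `|\int[leb2]_(x in D) (f x * v x)| <= c.

Lemma testedD c s f h : tested c f -> tested s h -> tested (c + s) (fun x => f x + h x).
Proof.
move=> [mf [If fc]] [mh [Ih hs]]; split; first exact: measurable_funD.
under [X in `|X|]eq_Rintegral do rewrite mulrDl.
rewrite RintegralD//; split; last by rewrite (le_trans (ler_normD _ _))// lerD.
apply: eq_integrable (integrableD mD If Ih) => // x _.
by rewrite /= mulrDl EFinD.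
Qed.

Lemma testedZ c s f : tested c f -> tested (`|s| * c) (fun x => s * f x).
Proof.
move=> [mf [If fc]]; split; first exact: measurable_funM.
under [X in `|X|]eq_Rintegral do rewrite -mulrA.
rewrite RintegralZl//; split; last by rewrite normrM ler_wpM2l.
apply: eq_integrable (integrableZl mD s If) => // x _.
by rewrite /= -mulrA EFinM.
Qed.

Lemma testedN c f : tested c f -> tested c (fun x => - f x).
Proof.
move=> /(testedZ (-1)); rewrite normrN normr1 mul1r.
by under eq_fun do rewrite mulN1r.
Qed.

Lemma tested_ae c f h : measurable_fun D h -> {ae leb2, forall x, D x -> h x = f x} ->
  tested c f -> tested c h.
Proof.
move=> mh hf [mf [If fc]]; split=> //.
have mhv : measurable_fun D (EFin \o (fun x => h x * v x)).
  by apply/measurable_EFinP; exact: measurable_funM.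
have mfv : measurable_fun D (EFin \o (fun x => f x * v x)).
  by apply/measurable_EFinP; exact: measurable_funM.
have E : ae_eq leb2 D (EFin \o (fun x => h x * v x)) (EFin \o (fun x => f x * v x)).
  by apply: filterS hf => x hx Dx /=; rewrite hx.
split; last by rewrite /Rintegral (ae_eq_integral _ _ mD mhv mfv E).
apply/integrableP; split=> //.
rewrite (@ae_eq_integral _ _ _ _ _ (abse \o (EFin \o (fun x => f x * v x))))//.
- by case/integrableP : If.
- exact: measurableT_comp.
- exact: measurableT_comp.
- by apply: filterS hf => x hx Dx /=; rewrite hx.
Qed.

End tested.

Section difference.
Variables (R : realType) (D A : set (plane R)) (v : R * R -> R) (K0 K1 s delta : R).
Variables (U w : plane R -> C2 R) (G gm : 'I_2 -> plane R -> C2 R).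
Hypothesis mD : measurable D.
Hypothesis mA : measurable A.
Hypothesis muA : leb2 A = (s ^+ 2)%:E.
Hypothesis s0 : 0 <= s.
Hypothesis K00 : 0 <= K0.
Hypothesis K10 : 0 <= K1.
Hypothesis tv : test_function D v.
Hypothesis vK0 : forall x, `|v x| <= K0 * \1_A x.
Hypothesis vK1 : forall j x, `|'D_(dir R j) v x| <= K1 * \1_A x.
Hypothesis H1U : H1_grad setT U G.
Hypothesis L2w : L2 leb2 setT w.
Hypothesis H1w : H1_grad D w gm.
Hypothesis Uw : (L2norm leb2 setT (fun x => (U x - w x)%R) <= delta%:E)%E.

Lemma measurable_test : measurable_fun setT (v : plane R -> R).
Proof. exact: continuous_measurable_plane (test_function_continuous tv). Qed.

Lemma measurable_test_partial j :
  measurable_fun setT ((fun x => 'D_(dir R j) v x) : plane R -> R).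
Proof. exact: continuous_measurable_plane (test_function_partial_continuous (j := j) tv). Qed.

Lemma reim1_pairing D' (u : plane R -> C2 R) (phi : plane R -> R) (K n : R) :
    measurable D' -> D `<=` D' -> 0 <= K -> reim1 (fun f => measurable_fun D' f) u ->
    (L2norm leb2 D' u <= n%:E)%E -> measurable_fun setT phi ->
    (forall x, `|phi x| <= K * \1_A x) ->
  reim1 (tested D phi (n * K * s)) u.
Proof.
move=> mD' DD' K_0 mu un mphi phiK k; have [m1 m2] := mu k.
have mD1 (f : plane R -> R) : measurable_fun D' f -> measurable_fun D f.
  by move=> mf; exact: measurable_funS mf.
have h (f : plane R -> R) : measurable_fun D' f -> (forall x, `|f x| <= euclid (u x)) ->
    tested D phi (n * K * s) f.
  move=> mf fu; split; first exact: mD1.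
  apply: (L2norm_pairing mD mD' mA DD' muA s0 K_0 mu un (mD1 _ mf) _ _ _) => //.
  exact: measurable_funTS.
by split; apply: h => // x; case: (euclid_ge (u x) k).
Qed.

Lemma L2_pairing D' (u : plane R -> C2 R) (phi : plane R -> R) (K : R) :
    measurable D' -> D `<=` D' -> 0 <= K -> L2 leb2 D' u -> measurable_fun setT phi ->
    (forall x, `|phi x| <= K * \1_A x) ->
  reim1 (fun f => leb2.-integrable D (EFin \o (fun x => f x * phi x))) u.
Proof.
move=> mD' DD' K_0 [mu un] mphi phiK k.
have un' : (L2norm leb2 D' u <= (fine (L2norm leb2 D' u))%:E)%E.
  by rewrite fineK// ge0_fin_numE// /L2norm Lnorm_ge0.
by have [[_ [? _]] [_ [? _]]] := reim1_pairing mD' DD' K_0 mu un' mphi phiK k.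
Qed.

Lemma reim1_measurable_sub D' (u u' : plane R -> C2 R) :
    reim1 (fun f => measurable_fun D' f) u -> reim1 (fun f => measurable_fun D' f) u' ->
  reim1 (fun f => measurable_fun D' f) (fun x => u x - u' x).
Proof.
move=> mu mu' k; have [m1 m2] := mu k; have [m3 m4] := mu' k; split.
  rewrite (_ : (fun x => _) = (fun x => complex.Re (u x k 0) - complex.Re (u' x k 0))).
    exact: measurable_funB.
  by apply/funext => x; rewrite !C2E !reimE.
rewrite (_ : (fun x => _) = (fun x => complex.Im (u x k 0) - complex.Im (u' x k 0))).
  exact: measurable_funB.
by apply/funext => x; rewrite !C2E !reimE.
Qed.

Lemma tested_difference : reim1 (tested D v (delta * K0 * s)) (fun x => U x - w x).
Proof.
apply: (reim1_pairing measurableT (@subsetT _ _) K00 _ Uw measurable_test vK0).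
by apply: reim1_measurable_sub; [exact: H1U.1.1|exact: L2w.1].
Qed.

(** Both weak derivatives are tested against the same v supported in D, so the pairing of their
    difference with v is minus the pairing of U - w with the partial derivative of v. The bound thus
    involves the norm of U - w, at the price of K1. *)
Lemma tested_gradient_difference j :
  reim1 (tested D v (delta * K1 * s)) (fun x => G j x - gm j x).
Proof.
have DT := @subsetT _ D.
have DD : D `<=` D by [].
have [LG wG] := H1U.2 j; have [Lg wg] := H1w.2 j.
have IU := L2_pairing measurableT DT K10 H1U.1 (measurable_test_partial j) (vK1 j).
have Iw := L2_pairing mD DD K10 H1w.1 (measurable_test_partial j) (vK1 j).
have IG := L2_pairing measurableT DT K00 LG measurable_test vK0.
have Ig := L2_pairing mD DD K00 Lg measurable_test vK0.
have T := reim1_pairing measurableT DT K10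
  (reim1_measurable_sub H1U.1.1 L2w.1) Uw (measurable_test_partial j) (vK1 j).
have h (u1 u2 g1 g2 k : plane R -> R) : weak_partial setT j u1 g1 -> weak_partial D j u2 g2 ->
    leb2.-integrable D (EFin \o (fun x => u1 x * 'D_(dir R j) v x)) ->
    leb2.-integrable D (EFin \o (fun x => u2 x * 'D_(dir R j) v x)) ->
    leb2.-integrable D (EFin \o (fun x => g1 x * v x)) ->
    leb2.-integrable D (EFin \o (fun x => g2 x * v x)) ->
    measurable_fun D g1 -> measurable_fun D g2 ->
    k = (fun x => u1 x - u2 x) ->
    tested D (fun x => 'D_(dir R j) v x) (delta * K1 * s) k ->
    tested D v (delta * K1 * s) (fun x => g1 x - g2 x).
  move=> w1 w2 I1 I2 J1 J2 m1 m2 kE [_ [_ kb]].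
  split; first exact: measurable_funB.
  under [X in `|X|]eq_Rintegral do rewrite mulrBl.
  have EI : \int[leb2]_(x in D) (k x * 'D_(dir R j) v x) =
      \int[leb2]_(x in D) (u1 x * 'D_(dir R j) v x) - \int[leb2]_(x in D) (u2 x * 'D_(dir R j) v x).
    by rewrite -RintegralB//; apply: eq_Rintegral => x _; rewrite kE mulrBl.
  rewrite EI in kb; rewrite RintegralB//; split.
    apply: eq_integrable (integrableB mD J1 J2) => // x _.
    by rewrite /= mulrBl EFinB.
  have := weak_partialS w1 tv; have := w2 v tv => e1 e2.
  by move: kb; rewrite e1 e2 -opprD normrN.
have mDT (f : plane R -> R) : measurable_fun setT f -> measurable_fun D f by exact: measurable_funTS.
move=> k; have [IU1 IU2] := IU k; have [Iw1 Iw2] := Iw k; have [IG1 IG2] := IG k.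
have [Ig1 Ig2] := Ig k; have [T1 T2] := T k; have [wG1 wG2] := wG k; have [wg1 wg2] := wg k.
have [mG1 mG2] := LG.1 k; have [mg1 mg2] := Lg.1 k.
split.
  rewrite (_ : (fun x => _) = (fun x => complex.Re (G j x k 0) - complex.Re (gm j x k 0))).
    apply: (h _ _ _ _ _ wG1 wg1 IU1 Iw1 IG1 Ig1 (mDT _ mG1) mg1 _ T1).
    by apply/funext => x; rewrite !C2E !reimE.
  by apply/funext => x; rewrite !C2E !reimE.
rewrite (_ : (fun x => _) = (fun x => complex.Im (G j x k 0) - complex.Im (gm j x k 0))).
  apply: (h _ _ _ _ _ wG2 wg2 IU2 Iw2 IG2 Ig2 (mDT _ mG2) mg2 _ T2).
  by apply/funext => x; rewrite !C2E !reimE.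
by apply/funext => x; rewrite !C2E !reimE.
Qed.

Variables (m eta tau e : R) (z : R[i]).
Hypothesis eqw : {ae leb2, forall x, D x ->
  dirac_expr m G U x + localized (interaction eta tau) e x *m U x - z *: U x + z *: w x =
  dirac_expr m gm w x}.

(** The terms without derivatives are paired with v and give K0; each real equation contains two
    partial derivatives, each of which gives K1. *)
Let M := delta * s * ((`|complex.Re z - m| + `|complex.Im z|) * K0 + 2 * K1).

(** On D only the equation for U contains a potential. Subtracting the two equations expresses it as
    z (U - w) minus the free Dirac expression of U - w, and every term of the latter is controlled
    when paired with v. The first component is the one used. *)
Lemma tested_potential (h1 h2 : plane R -> R) :
    (forall x, h1 x = complex.Re ((localized (interaction eta tau) e x *m U x) 0 0)) ->
    (forall x, h2 x = complex.Im ((localized (interaction eta tau) e x *m U x) 0 0)) ->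
    measurable_fun setT h1 -> measurable_fun setT h2 ->
  tested D v M h1 /\ tested D v M h2.
Proof.
move=> h1E h2E mh1 mh2.
have mDT (f : plane R -> R) : measurable_fun setT f -> measurable_fun D f by exact: measurable_funTS.
have [kr ki] := tested_difference 0.
have [_ Gi] := tested_gradient_difference 0 1; have [Gr _] := tested_gradient_difference 0 1.
have [Hr Hi] := tested_gradient_difference 1 1.
have ME : M = `|complex.Re z - m| * (delta * K0 * s) + `|complex.Im z| * (delta * K0 * s) +
   (delta * K1 * s + delta * K1 * s) by rewrite /M; ring.
have mv := measurable_funTS measurable_test.
split; rewrite ME.
- apply: (tested_ae mD (mv D) (mDT _ mh1) _ (testedD mD (testedD mD (testedZ mD (complex.Re z - m) kr)
    (testedN mD (testedZ mD (complex.Im z) ki))) (testedD mD (testedN mD Gi) Hr))).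
  apply: filterS eqw => x + Dx => /(_ Dx).
  have := dirac_expr_components m G U x; have := dirac_expr_components m gm w x.
  have := h1E x; move: (_ *m U x) (dirac_expr m G U x) (dirac_expr m gm w x).
  move=> c a b -> [b1 b2 _ _] [a1 a2 _ _] /(congr1 (fun u : C2 R => complex.Re (u 0 0))).
  by rewrite !C2E !Re_add !Re_opp !Re_mul a1 b1 !reimE; lra.
- apply: (tested_ae mD (mv D) (mDT _ mh2) _ (testedD mD (testedD mD (testedZ mD (complex.Re z - m) ki)
    (testedZ mD (complex.Im z) kr)) (testedD mD Gr Hi))).
  apply: filterS eqw => x + Dx => /(_ Dx).
  have := dirac_expr_components m G U x; have := dirac_expr_components m gm w x.
  have := h2E x; move: (_ *m U x) (dirac_expr m G U x) (dirac_expr m gm w x).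
  move=> c a b -> [b1 b2 _ _] [a1 a2 _ _] /(congr1 (fun u : C2 R => complex.Im (u 0 0))).
  by rewrite !C2E !Im_add !Im_opp !Im_mul a2 b2 !reimE; lra.
Qed.

End difference.

Lemma quarter_bounds (R : realType) (e y : R) : 0 < e -> e / 4 <= y -> y <= 3 * e / 4 ->
  - e < y < e /\ 0 <= y <= e.
Proof. by move=> e0 y1 y2; split; apply/andP; split; lra. Qed.

Lemma sin_two_fifths_gt0 (R : realType) (w : R) : pi / 4 < w < pi / 2 -> 0 < sin (w * (2 / 5)).
Proof.
move=> /andP[w1 w2]; have pi0 := @pi_gt0 R.
by apply: sin_gt0_pi; apply/andP; split; lra.
Qed.

(** * Oscillating test functions and the lower bound *)

Section test_mode.
Variables (R : realType) (m eta tau g w k e N B1 : R).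
Hypothesis w_itv : pi / 4 < w < pi / 2.
Hypothesis gw : g * sin (2 * w) = w.
Hypothesis kE : k = - g * cos (2 * w).
Hypothesis e_gt0 : 0 < e.
Hypothesis N_ge0 : 0 <= N.
Hypothesis B1_ge0 : 0 <= B1.
Hypothesis B1_bound : forall s,
  `|((@bumpR R)^`())%classic s| <= B1 * \1_(`[(-1)%R, 1%R]%classic : set R) s.

Notation unit_itv := (`[(-1)%R, 1%R]%classic : set R).

Let einv_ge0 : 0 <= e^-1.
Proof. by rewrite invr_ge0 ltW. Qed.

Definition cutoff s := bumpR (e^-1 * s).

Lemma smooth_cutoff : smooth cutoff.
Proof.
move=> n; rewrite (_ : cutoff = fun s => bumpR (e^-1 * s + 0)).
  exact: Cn_affine (smooth_bump R n).
by apply/funext => s; rewrite addr0.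
Qed.

Lemma derive_cutoff s :
  (cutoff^`())%classic s = e^-1 * ((@bumpR R)^`())%classic (e^-1 * s).
Proof.
have db : is_derive (e^-1 * s + 0) 1 (@bumpR R) (((@bumpR R)^`())%classic (e^-1 * s)).
  by rewrite addr0 derive1E; apply: DeriveDef => //; exact: (CnS_derivable (smooth_bump R 1)).
have := is_derive_affine db; under eq_fun do rewrite addr0.
by move=> dc; rewrite derive1E; apply: derive_val.
Qed.

Lemma cutoff_out s : cutoff s != 0 -> e / 4 <= s <= 3 * e / 4.
Proof.
move=> c0; have : 4^-1 < e^-1 * s < 3 / 4.
  by apply: contraNT c0 => /bump_out; rewrite /cutoff => ->.
rewrite mulrC ltr_pdivlMr// ltr_pdivrMr// => /andP[c1 c2].
by apply/andP; split; lra.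
Qed.

Lemma indic_scale s : \1_unit_itv (e^-1 * s) = \1_(`[(- e)%R, e]%classic : set R) s :> R.
Proof.
rewrite !indicE; congr (nat_of_bool _)%:R; apply/idP/idP; rewrite !inE/= !in_itv/=.
  by rewrite mulrC ler_pdivlMr// ler_pdivrMr// mulN1r mul1r.
by rewrite mulrC ler_pdivlMr// ler_pdivrMr// mulN1r mul1r.
Qed.

Lemma cutoff_le s : `|cutoff s| <= 1 * \1_(`[(- e)%R, e]%classic : set R) s.
Proof. by rewrite mul1r ger0_norm ?bump_ge0// -indic_scale; exact: bump_indic. Qed.

Lemma derive_cutoff_le s :
  `|(cutoff^`())%classic s| <= (e^-1 * B1) * \1_(`[(- e)%R, e]%classic : set R) s.
Proof.
rewrite derive_cutoff normrM (ger0_norm einv_ge0) -mulrA -indic_scale.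
by rewrite ler_wpM2l.
Qed.

Definition test_box : set (plane R) := `[(- e)%R, e]%classic `*` unit_itv.

Lemma measurable_test_box : measurable test_box.
Proof. by apply: measurableX; exact: measurable_itv. Qed.

Lemma leb2_test_box : leb2 test_box = ((2 * Num.sqrt e) ^+ 2)%:E.
Proof.
rewrite leb2_box//; last first.
have -> : lebesgue_measure (`[(- e)%R, e]%classic : set R) = (2 * e)%:E.
  rewrite lebesgue_measure_itv/= lte_fin gtrN//.
  by rewrite -EFinD; congr EFin; ring.
have -> : lebesgue_measure unit_itv = 2%:E.
  rewrite lebesgue_measure_itv/= lte_fin ifT; last by lra.
  by rewrite -EFinD; congr EFin; lra.
by rewrite -EFinM exprMn sqr_sqrtr ?ltW//; congr EFin; ring.
Qed.

Lemma tensor_box (X E : R -> R) K L x :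
    (forall s, `|X s| <= K * \1_(`[(- e)%R, e]%classic : set R) s) ->
    (forall s, `|E s| <= L * \1_unit_itv s) ->
  `|tensor X E x| <= K * L * \1_test_box x.
Proof.
move=> XK EL.
have -> : \1_test_box x = \1_(`[(- e)%R, e]%classic : set R) x.1 * \1_unit_itv x.2 :> R.
  rewrite !indicE -natrM mulnb; congr (nat_of_bool _)%:R; apply/idP/andP.
    by rewrite inE => -[? ?]; split; rewrite inE.
  by move=> []; rewrite !inE.
by rewrite /tensor normrM mulrACA ler_pM.
Qed.

(** It has the frequency k / e of the quasimode. The values (1, 0) and (0, 1) of (C, S) will be
    paired with the real and the imaginary part of the potential term. *)
Definition test_mode C S : R * R -> R := tensor cutoff (osc k e C S).

Lemma osc_out C S s : osc k e C S s != 0 -> 4^-1 <= s <= 3 / 4.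
Proof.
move=> o0; have /andP[s1 s2] : 4^-1 < s < 3 / 4; last by rewrite !ltW.
by apply: contraNT o0 => /bump_out; rewrite /osc => ->; rewrite mul0r.
Qed.

Lemma test_mode_test C S : test_function (@Omega_minus R) (test_mode C S).
Proof.
apply: test_function_tensor smooth_cutoff (smooth_osc k e C S) cutoff_out (@osc_out C S) _.
by move=> x /andP[x1 _]; apply: lt_le_trans x1; rewrite divr_gt0.
Qed.

Lemma test_mode_le C S x : `|test_mode C S x| <= (`|C| + `|S|) * \1_test_box x.
Proof.
rewrite -[_ + _]mul1r; apply: tensor_box; [exact: cutoff_le|exact: osc_le].
Qed.

(** Up to the factor |C| + |S| the derivative in x1 costs B1 / e and the oscillation in x2 costs B1
    + k / e; for e <= 1 both are at most (B1 + k) / e. *)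
Lemma test_mode_partial_le C S j x : e <= 1 ->
  `|'D_(dir R j) (test_mode C S) x| <= e^-1 * (B1 + k) * (`|C| + `|S|) * \1_test_box x.
Proof.
move=> e1.
have k0 := ltW (k_gt0 w_itv gw kE).
have einv1 : 1 <= e^-1 by rewrite invf_ge1.
have CS : 0 <= `|C| + `|S| by rewrite addr_ge0.
have [_ ->] := tensor_derive j x (CnS_derivable (smooth_cutoff 1))
  (CnS_derivable (smooth_osc k e C S 1)).
have i0 : 0 <= \1_test_box x :> R by [].
case: ifP => _.
- apply: le_trans (tensor_box x derive_cutoff_le (@osc_le _ k e C S)) _.
  by rewrite ler_wpM2r// ler_wpM2r// ler_wpM2l// lerDl.
- rewrite (derive_osc k e C S).
  apply: le_trans (tensor_box x cutoff_le (dosc_le w_itv gw kE e_gt0 B1_bound C S)) _.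
  rewrite mul1r ler_wpM2r// ler_wpM2r// mulrDr [X in _ <= _ + X]mulrC lerD2r.
  by rewrite ler_peMl.
Qed.

Notation A := (N * g).
Notation a := ((eta + tau) / 2).

Definition potential_component C S (x : plane R) : R :=
  (2 * e)^-1 * \1_([set y : plane R | - e < y.1 < e]) x * (eta + tau) *
  tensor (amp0 w k e) (osc k e C S) x.

Lemma measurable_potential_component C S :
  measurable_fun setT (potential_component C S).
Proof.
have ms : measurable ([set y | - e < y.1 < e] : set (plane R)).
  rewrite (_ : [set y | _] = fst @^-1` `](- e)%R, e[%classic).
    by rewrite -[X in measurable X]setTI; apply: measurable_fst => //; exact: measurable_itv.
  by apply/seteqP; split=> x /=; rewrite in_itv.
apply: measurable_funM.
  by apply: measurable_funM => //; apply: measurable_funM => //; exact: measurable_indic.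
by apply: measurable_tensor; [exact: (bounded_measurable_profile w_itv gw kE _).1|exact: measurable_osc].
Qed.

(** Here every bump is at least e^(- 4) and the reflected profile is at least sin (2 w / 5). *)
Definition core_box : set (plane R) := `[2 / 5 * e, 3 / 5 * e]%classic `*` `[2 / 5, 3 / 5]%classic.

(** Cosine against cosine plus sine against sine is 1, so the oscillation disappears and the
    integrand is nonnegative everywhere. The outer factor a produces a^2 and removes the sign of eta
    + tau. The cube counts one bump in x1 and two in x2, one from the quasimode and one from the
    test function. *)
Lemma core_lower (x : plane R) : a * (potential_component A 0 x * test_mode 1 0 x +
    potential_component 0 A x * test_mode 0 1 x) >=
  a ^+ 2 * (e^-1 * A * (sin (w * (2 / 5)) * expR (- 4) ^+ 3)) * \1_core_box x.
Proof.
have g0 := ltW (g_gt0 w_itv gw).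
have A0 : 0 <= A by rewrite mulr_ge0.
have E0 : 0 <= expR (- 4 : R) by exact: expR_ge0.
(* Where the cut-off vanishes the point is outside the core box, and both sides are 0. *)
have [x0|x0] := boolP (cutoff x.1 == 0).
  rewrite /test_mode /tensor (eqP x0) !mul0r !mulr0 addr0 mulr0 indicE.
  rewrite (_ : (x \in core_box) = false) ?mulr0//; apply/negP; rewrite inE => -[].
  rewrite /= in_itv/= => /andP[x1 x2] _.
  have : expR (- 4) <= cutoff x.1.
    by apply: bump_ge; rewrite [e^-1 * _]mulrC ler_pdivlMr// ler_pdivrMr// x1.
  by rewrite (eqP x0) leNgt expR_gt0.
have /andP[c1 c2] := cutoff_out x0.
have chi1 : \1_([set y : plane R | - e < y.1 < e]) x = 1 :> R.
  by rewrite indicE mem_set//=; case: (quarter_bounds e_gt0 c1 c2).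
have PE : amp0 w k e x.1 = profile w k (- (e^-1 * x.1)) by rewrite /amp0 mulNr.
have s01 : 0 <= e^-1 * x.1 <= 1.
  rewrite mulrC ler_pdivlMr// ler_pdivrMr// mul0r mul1r.
  by case: (quarter_bounds e_gt0 c1 c2).
have P0 : 0 <= amp0 w k e x.1 by rewrite PE; exact: (profileN_ge0 k w_itv s01).
have -> : a * (potential_component A 0 x * test_mode 1 0 x +
    potential_component 0 A x * test_mode 0 1 x) =
  a ^+ 2 * (e^-1 * A * (amp0 w k e x.1 * (cutoff x.1 * (bumpR x.2 * bumpR x.2)))) *
  (cos (k / e * x.2) ^+ 2 + sin (k / e * x.2) ^+ 2).
  rewrite /potential_component /test_mode /tensor /osc /carrier chi1.
  by field; rewrite gt_eqF.
rewrite cos2Dsin2 mulr1 -[leLHS]mulrA ler_wpM2l ?sqr_ge0// -[leLHS]mulrA.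
rewrite ler_wpM2l//; first by rewrite mulr_ge0.
have rhs0 : 0 <= amp0 w k e x.1 * (cutoff x.1 * (bumpR x.2 * bumpR x.2)).
  by apply: (mulr_ge0 P0); apply: mulr_ge0; [|apply: mulr_ge0]; exact: bump_ge0.
rewrite indicE; have [|xc] := boolP (x \in core_box); last by rewrite !mulr0.
rewrite inE => -[]; rewrite /= !in_itv/= => /andP[x1 x2] x3.
have s1 : 2 / 5 <= e^-1 * x.1 <= 3 / 5.
  by rewrite [e^-1 * _]mulrC ler_pdivlMr// ler_pdivrMr// x1.
have sin0 := ltW (sin_two_fifths_gt0 w_itv).
rewrite mulr1 exprS expr2 PE; apply: ler_pM; [by []|by apply: mulr_ge0 => //; exact: mulr_ge0| |].
  exact: (profileN_ge k w_itv s1).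
apply: ler_pM; [by []|exact: mulr_ge0|exact: bump_ge|].
by apply: ler_pM => //; exact: bump_ge.
Qed.

End test_mode.

(** * The contradiction of scales *)

Section main.
Variable R : realType.

Lemma leb2_core_box (e : R) : 0 < e -> leb2 (core_box e) = (e / 25)%:E.
Proof.
move=> e0; rewrite leb2_box//.
have -> : lebesgue_measure (`[2 / 5 * e, 3 / 5 * e]%classic : set R) = (e / 5)%:E.
  rewrite lebesgue_measure_itv/= lte_fin ltr_pM2r// ifT; last by lra.
  by rewrite -EFinD; congr EFin; field.
have -> : lebesgue_measure (`[2 / 5, 3 / 5]%classic : set R) = (5^-1)%:E.
  rewrite lebesgue_measure_itv/= lte_fin ifT; last by lra.
  by rewrite -EFinD; congr EFin; lra.
by rewrite -EFinM; congr EFin; field.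
Qed.

Lemma core_box_sub (e : R) : 0 < e -> core_box e `<=` @Omega_minus R.
Proof.
move=> e0 x [+ _]; rewrite /= in_itv/= => /andP[x1 _].
by apply: lt_le_trans x1; rewrite mulr_gt0// divr_gt0.
Qed.

Lemma measurable_core_box (e : R) : measurable (core_box e).
Proof. by apply: measurableX; exact: measurable_itv. Qed.

Lemma core_integral_le (e c M M' a : R) (h1 h2 v1 v2 : plane R -> R) : 0 < e ->
    measurable_fun setT v1 -> measurable_fun setT v2 ->
    tested (@Omega_minus R) v1 M h1 -> tested (@Omega_minus R) v2 M' h2 ->
    (forall x, c * \1_(core_box e) x <= a * (h1 x * v1 x + h2 x * v2 x)) ->
  c * (e / 25) <= `|a| * (M + M').
Proof.
move=> e0 mv1 mv2 [_ [I1 b1]] [_ [I2 b2]] low.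
have mD := @measurable_Omega_minus R; set D := @Omega_minus R in mD I1 b1 I2 b2 *.
have mc := measurable_core_box e.
have coreD : core_box e `&` D = core_box e by apply/setIidPl; exact: core_box_sub.
have Ic : leb2.-integrable D (EFin \o (\1_(core_box e) : plane R -> R)).
  apply: (@integrable_bounded _ _ R leb2 D (core_box e) _ 1) => //.
  - by rewrite leb2_core_box// ltry.
  - by move=> x _; rewrite mul1r ger0_norm.
have I12 : leb2.-integrable D (EFin \o (fun x => h1 x * v1 x + h2 x * v2 x)).
  by apply: eq_integrable (integrableD mD I1 I2).
have IcZ : leb2.-integrable D (EFin \o (fun x => c * \1_(core_box e) x)).
  by apply: eq_integrable (integrableZl mD c Ic).
have IaZ : leb2.-integrable D (EFin \o (fun x => a * (h1 x * v1 x + h2 x * v2 x))).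
  by apply: eq_integrable (integrableZl mD a I12).
have := le_Rintegral mD IcZ IaZ (fun x _ => low x).
rewrite RintegralZl// RintegralZl// RintegralD//.
rewrite [X in c * X](_ : _ = e / 25); last first.
  by rewrite /Rintegral integral_indic// coreD leb2_core_box.
move=> /le_trans; apply; rewrite (le_trans (ler_norm _))// normrM ler_wpM2l//.
by rewrite (le_trans (ler_normD _ _))// lerD.
Qed.

(** After multiplication by r, the square root of e, the left-hand side is 4 |a| C0 and the
    right-hand side is 4 |a| delta (e T + 2 (B1 + k)). As e <= 1, the choice of delta makes the
    latter smaller than |a| C0. *)
Lemma scaling_contradiction (a s0 g K k B1 T delta e r sk N C0 : R) :
    0 < e -> e <= 1 -> 0 < r -> r ^+ 2 = e -> 0 < sk -> 0 < K -> 0 <= T -> 0 <= B1 ->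
    0 <= k -> a != 0 -> 0 < g -> 0 < s0 ->
    N = (2 * K * (r * sk))^-1 ->
    C0 = `|a| * g * s0 / (200 * K * sk) ->
    delta = C0 / (4 * (T + 2 * (B1 + k) + 1)) ->
    a ^+ 2 * (e^-1 * (N * g) * s0) * (e / 25) <=
      `|a| * (delta * (2 * r) * (T * 1 + 2 * (e^-1 * (B1 + k))) +
              delta * (2 * r) * (T * 1 + 2 * (e^-1 * (B1 + k)))) -> False.
Proof.
move=> e0 e1 r0 rE sk0 K_0 T0 B10 k0 a0 g0 s00 NE CE dE H.
have na0 : 0 < `|a| by rewrite normr_gt0.
have C00 : 0 < C0.
  rewrite CE; apply: divr_gt0; first by apply: mulr_gt0 => //; exact: mulr_gt0.
  have p200 : 0 < 200 :> R by rewrite ltr0n.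
  exact: (mulr_gt0 (mulr_gt0 p200 K_0) sk0).
have X0 : 0 <= T + 2 * (B1 + k) by rewrite addr_ge0// mulr_ge0// addr_ge0.
have d0 : 0 < delta by rewrite dE divr_gt0// mulr_gt0//; lra.
have {}H : `|a| * (4 * C0) <= `|a| * (4 * delta * (e * T + 2 * (B1 + k))).
  move: H; rewrite -(ler_pM2r r0).
  rewrite -(real_normK (num_real a)) -rE NE CE.
  congr (_ <= _); field; rewrite ?gt_eqF//.
move: H; rewrite (ler_pM2l na0) => H.
have : 4 * C0 <= 4 * delta * (T + 2 * (B1 + k)).
  apply: le_trans H _; rewrite ler_wpM2l ?mulr_ge0 ?(ltW d0)// lerD2r.
  by rewrite ler_piMl.
have : delta * (4 * (T + 2 * (B1 + k) + 1)) = C0.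
  by rewrite dE divfK// gt_eqF// mulr_gt0//; lra.
nra.
Qed.

End main.

Theorem theorem3p2 (R : realType) (m eta tau : R) :
  let d := eta ^+ 2 - tau ^+ 2 in
  let eta' := tanc (Num.sqrt d / 2) * eta in
  let tau' := tanc (Num.sqrt d / 2) * tau in
  pi ^+ 2 / 4 < d ->
  (forall k : nat, d != (2 * k + 1)%:R ^+ 2 * pi ^+ 2) ->
  eta' ^+ 2 - tau' ^+ 2 != 4 ->
  ~ norm_resolvent_cvg
      (fun eps => dirac_potential m (localized (interaction eta tau) eps))
      (dirac_delta m (interaction eta' tau')).
Proof.
move=> d eta' tau' dpi _ _ [z Imz [Se [S [RS RT Scvg]]]].
have pi0 := @pi_gt0 R.
pose g := Num.sqrt d / 2.
have d0 : 0 <= d by apply: ltW; apply: le_lt_trans dpi; rewrite divr_ge0// sqr_ge0.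
have g4 : pi / 4 < g.
  have : Num.sqrt ((pi / 2) ^+ 2) < Num.sqrt d.
    rewrite ltr_sqrt; last by apply: le_lt_trans dpi; rewrite divr_ge0// sqr_ge0.
    by rewrite expr_div_n -natrX.
  by rewrite sqrtr_sqr ger0_norm /g; lra.
have [w w_itv gw] := exists_omega g4.
pose k := - g * cos (2 * w).
have kE : k = - g * cos (2 * w) by [].
have k0 := k_gt0 w_itv gw kE; have g0 := g_gt0 w_itv gw.
have abE : (eta + tau) / 2 * ((eta - tau) / 2) = g ^+ 2.
  by rewrite /g expr_div_n sqr_sqrtr// /d; field.
pose a := (eta + tau) / 2.
have a0 : a != 0.
  apply/eqP => aE; have : 0 < g ^+ 2 by rewrite exprn_gt0.
  by rewrite -abE -/a aE mul0r ltxx.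
have [B1 B10 B1b] := derive_bump_bound R.
pose K := expR k * (g + `|a|) * (B1 + `|m| + `|complex.Re z| + `|complex.Im z|).
have K_0 : 0 < K.
  apply: mulr_gt0; first by apply: mulr_gt0; [exact: expR_gt0|rewrite ltr_wpDr].
  by rewrite ltr_wpDl ?normr_gt0// !addr_ge0.
pose T := `|complex.Re z - m| + `|complex.Im z|.
have T0 : 0 <= T by rewrite addr_ge0.
pose sk := Num.sqrt (2 / k).
have sk0 : 0 < sk by rewrite sqrtr_gt0 divr_gt0.
pose s0 := sin (w * (2 / 5)) * expR (- 4) ^+ 3.
have s00 : 0 < s0 by rewrite mulr_gt0 ?sin_two_fifths_gt0// exprn_gt0// expR_gt0.
(* In 200 = 25 * 2 * 4 the 25 comes from the area e / 25 of the core box, the 2 from N, and the 4 is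
   slack. *)
pose C0 := `|a| * g * s0 / (200 * K * sk).
(* Nothing here depends on e, so e can be chosen afterwards. The summand 1 makes the final
   inequality strict. *)
pose delta := C0 / (4 * (T + 2 * (B1 + k) + 1)).
have delta0 : 0 < delta.
  have na0 : 0 < `|a| by rewrite normr_gt0.
  have C00 : 0 < C0.
    apply: divr_gt0; first by apply: mulr_gt0 => //; exact: mulr_gt0.
    have p200 : 0 < 200 :> R by rewrite ltr0n.
    exact: (mulr_gt0 (mulr_gt0 p200 K_0) sk0).
  apply: divr_gt0 => //; apply: mulr_gt0 => //.
  by rewrite ltr_wpDl// addr_ge0// mulr_ge0// addr_ge0// ltW.
have [e [e0 e1 Sdelta]] : exists e : R, [/\ 0 < e, e < 1 &
    (opnorm (fun f x => (Se e f x - S f x)%R) < delta%:E)%E].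
  have near_delta : \forall e \near (0 : R)^'+,
      (opnorm (fun f x => (Se e f x - S f x)%R) < delta%:E)%E.
    have : nbhs (0%E : \bar R) [set y | (y < delta%:E)%E].
      by apply: open_nbhs_nbhs; split; [exact: open_ereal_lt_ereal|rewrite /= lte_fin].
    by move/Scvg.
  have near_e : \forall e \near (0 : R)^'+, [/\ 0 < e, e < 1 &
      (opnorm (fun f x => (Se e f x - S f x)%R) < delta%:E)%E].
    near=> e; split.
    - by near: e; exact: nbhs_right_gt.
    - by near: e; exact: nbhs_right_lt.
    - by near: e.
  by have /filter_ex[e eP] := near_e; exists e.
(* This N turns the bound of [quasimode_resid_L2] into 1: F then lies in the unit ball over which
   [opnorm] is a supremum. *)
pose N := (2 * K * (Num.sqrt e * sk))^-1.
have re0 : 0 < Num.sqrt e by rewrite sqrtr_gt0.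
have den0 : 0 < 2 * K * (Num.sqrt e * sk) by apply: mulr_gt0; exact: mulr_gt0.
have N0 : 0 <= N by rewrite invr_ge0 ltW.
pose U := quasimode eta tau g w k e N.
pose F x := quasimode_image m eta tau g w k e N x - z *: U x.
have [L2F F1] : L2 leb2 setT F /\ (L2norm leb2 setT F <= 1)%E.
  have [L2F Fle] := quasimode_resid_L2 m w_itv gw kE abE e0 N0 B10 B1b z.
  split=> //; apply: le_trans Fle _; rewrite lee_fin -/K.
  have -> : 2 / (k / e) = e * (2 / k) by field; rewrite !gt_eqF.
  rewrite sqrtrM ?(ltW e0)// -/sk.
  rewrite (_ : 2 * (N * K) * _ = N * (2 * K * (Num.sqrt e * sk))); last by ring.
  by rewrite /N mulVf// gt_eqF.
have [RT1 _ _] := RT; have [RS1 RS2 _] := RS e e0.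
(* F is the image of U under H_{V_e} - z by construction, so the resolvent returns U, though only
   almost everywhere; hence the passage through [L2norm_ae] below. *)
have SeU : {ae leb2, forall x, Se e F x = U x}.
  exact: RS2 (quasimode_dom m w_itv gw kE abE e0 N0 B10 B1b).
have [L2w [_ _ [gp [gm [tp [tm [[_ H1w] _ _ _ eqw]]]]]]] := RT1 F L2F.
pose u := S F.
have H1U := quasimode_H1 eta tau w_itv gw kE e0 N0 B10 B1b.
have Uw : (L2norm leb2 setT (fun x => (U x - u x)%R) <= delta%:E)%E.
  rewrite -(L2norm_ae (u := fun x => Se e F x - u x)).
  - apply: le_trans (ltW Sdelta); apply: ereal_sup_ubound; exists F => //.
  - by apply: reim1_measurable_sub; [exact: (RS1 F L2F).1.1|exact: L2w.1].
  - by apply: reim1_measurable_sub; [exact: H1U.1.1|exact: L2w.1].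
  - by apply: filterS SeU => x ->.
have eqU : {ae leb2, forall x, Omega_minus x ->
    dirac_expr m (quasimode_grad eta tau g w k e N) U x +
    localized (interaction eta tau) e x *m U x - z *: U x + z *: u x =
    dirac_expr m gm u x} by exact: eqw.
have mO := @measurable_Omega_minus R.
have r20 : 0 <= 2 * Num.sqrt e by rewrite mulr_ge0// ltW.
have K10 : 0 <= e^-1 * (B1 + k) by rewrite mulr_ge0 ?invr_ge0 ?addr_ge0// ltW.
have test_bounds C1 C2 : `|C1| + `|C2| = 1 :> R ->
    (forall x, `|test_mode k e C1 C2 x| <= 1 * \1_(test_box e) x) /\
    (forall j x, `|'D_(dir R j) (test_mode k e C1 C2) x| <= e^-1 * (B1 + k) * \1_(test_box e) x).
  move=> C12; split=> [x|j x].
    by have := test_mode_le k e0 C1 C2 x; rewrite C12.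
  by have := test_mode_partial_le w_itv gw kE e0 B10 B1b C1 C2 j x (ltW e1); rewrite C12 mulr1.
have [b1 b2] := test_bounds 1 0 (ltac:(by rewrite normr1 normr0 addr0)).
have [b3 b4] := test_bounds 0 1 (ltac:(by rewrite normr1 normr0 add0r)).
have UE x := spinorE (tensor (amp0 w k e) (osc k e (N * g) 0)) (tensor (amp0 w k e) (osc k e 0 (N * g)))
  (tensor (amp1 w k e) (osc k e 0 (N * a))) (tensor (amp1 w k e) (osc k e (- (N * a)) 0)) x.
have h1E x : potential_component eta tau w k e (N * g) 0 x =
    complex.Re ((localized (interaction eta tau) e x *m U x) 0 0).
  have [-> _ _ _] := localized_components eta tau e x (U x).
  by rewrite /U /quasimode (UE x).1.
have h2E x : potential_component eta tau w k e 0 (N * g) x =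
    complex.Im ((localized (interaction eta tau) e x *m U x) 0 0).
  have [_ -> _ _] := localized_components eta tau e x (U x).
  by rewrite /U /quasimode (UE x).1.
have mh1 := measurable_potential_component eta tau e w_itv gw kE (N * g) 0.
have mh2 := measurable_potential_component eta tau e w_itv gw kE 0 (N * g).
have t1 := test_mode_test k e0 1 0; have t2 := test_mode_test k e0 0 1.
have [T1 _] := tested_potential mO (measurable_test_box e) (leb2_test_box e0) r20 ler01 K10
  t1 b1 b2 H1U L2w H1w Uw eqU h1E h2E mh1 mh2.
have [_ T2] := tested_potential mO (measurable_test_box e) (leb2_test_box e0) r20 ler01 K10
  t2 b3 b4 H1U L2w H1w Uw eqU h1E h2E mh1 mh2.
have low := core_lower eta tau k w_itv gw e0 N0.
have := core_integral_le e0 (measurable_test t1) (measurable_test t2) T1 T2 low.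
by apply: (scaling_contradiction e0 (ltW e1) re0 _ sk0 K_0 T0 B10 (ltW k0) a0 g0 s00); rewrite ?sqr_sqrtr ?ltW.
Unshelve. all: by end_near. Qed.
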